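(* Let $\Phi=(\Phi_1,\dots,\Phi_n)$ be an $n$-variable polynomial map with coefficients in $\mathbb{Z}$, let $V$ be the Zariski closure (over $\mathbb{Z}$) of the image of the $n$-th iterate $\Phi^n$, and let $W$ be a proper closed subscheme of $V$. Then for every sufficiently large prime $p$ there exist a power $q=p^l$, a point $x\in V(\mathbb{F}_q)\setminus W(\mathbb{F}_q)$ and a positive integer $a$ such that for every $X\in V(\mathbb{Z}_q)$ with $\pi(X)=x$ and every natural number $k$, $$\Phi^{ap^k}(X)\equiv X \pmod{p^k}.$$ In particular, every such point $X$ is uniformly recurrent for $\Phi$ in the $p$-adic topology on $V(\mathbb{Z}_q)$.
   Context: $\Phi^m$ denotes the $m$-th composition power (iterate) of $\Phi$. $V$ is the closed subscheme of affine $n$-space over $\mathbb{Z}$ defined by the ideal $I(V(\mathbb{Z}))=\{f\in\mathbb{Z}[x_1,\dots,x_n] : f(\Phi^n)=0\}$, where $f(\Phi^n)$ is the polynomial obtained by substituting the components of $\Phi^n$ for the variables. For a commutative ring $R$, $V(R)$ is the set of points of $R^n$ at which all elements of $I(V(\mathbb{Z}))$ vanish, and $W(R)$ is the set of points of $R^n$ at which all elements of the ideal of $W$ vanish. For $q=p^l$, $\mathbb{Q}_q$ is the unramified extension of $\mathbb{Q}_p$ whose ring of integers $\mathbb{Z}_q$ has residue field $\mathbb{Z}_q/p\mathbb{Z}_q\cong\mathbb{F}_q$, and $\pi$ is (coordinatewise) reduction modulo $p$ from $\mathbb{Z}_q$ to $\mathbb{F}_q$. A point $X$ is uniformly recurrent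 for $\Phi$ if for every neighborhood $U$ of $X$ the set of $m\in\mathbb{N}$ with $\Phi^m(X)\in U$ is syndetic (has bounded gaps). *)

(* Defs.v *)
From HB Require Import structures.
From mathcomp Require Import all_boot all_order all_algebra all_field.
From mathcomp Require Import boolp.
From mathcomp Require Import mpoly.
From mathcomp Require Import zify.

Set Implicit Arguments.
Unset Strict Implicit.
Unset Printing Implicit Defensive.

Import GRing.Theory Num.Theory.
Local Open Scope ring_scope.

(* The p-adic integers are the inverse limit of the rings Z/p^k: the k-th entry
   of a sequence is its residue modulo p^k.  The compatibility condition also
   forces every entry to be the canonical representative, in [0, p^k). *)
Record padic_int (p : nat) (p_pr : prime p) := PadicInt {
  padic_res :> nat -> int;
  padic_resP : forall k, (padic_res k.+1 %% (p ^ k)%N%:Z)%Z = padic_res k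
}.

Section PadicInt.

Variables (p : nat) (p_pr : prime p).
Local Notation Zp := (padic_int p_pr).
Local Notation P k := ((p ^ k)%N%:Z).

HB.instance Definition _ := gen_eqMixin Zp.
HB.instance Definition _ := gen_choiceMixin Zp.

Lemma padic_eqP (x y : Zp) : (forall k, (x k = y k %[mod P k])%Z) -> x = y.
Proof.
case: x y => x xP [y yP] /= xy.
have {}xy : x = y.
  by apply: funext => k; rewrite -xP -(modz_mod (x _)) xP xy -yP modz_mod.
by case: _ / xy yP => yP; congr PadicInt; apply: Prop_irrelevance.
Qed.

Lemma modz_pow (a : int) k j : ((a %% P (k + j)%N)%Z = a %[mod P k])%Z.
Proof.
rewrite [in RHS](divz_eq a (P (k + j)%N)) [in X in _ * X]expnD PoszM.
by rewrite (mulrC (P k)) mulrA modzMDl.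
Qed.

Lemma padic_ofP (s : nat -> int) : (forall k, (s k.+1 = s k %[mod P k])%Z) ->
  forall k, ((s k.+1 %% P k.+1)%Z %% P k)%Z = (s k %% P k)%Z.
Proof. by move=> sP k; rewrite -addn1 modz_pow addn1 sP. Qed.

Definition padic_of s sP : Zp := PadicInt p_pr (@padic_ofP s sP).

Lemma padic_nextP (x : Zp) k : (x k.+1 = x k %[mod P k])%Z.
Proof. by rewrite -[in RHS](padic_resP x) modz_mod. Qed.

Lemma padic_cstP (a : int) k : (a = a %[mod P k])%Z. Proof. by []. Qed.

Lemma padic_addP (x y : Zp) k :
  (x k.+1 + y k.+1 = x k + y k %[mod P k])%Z.
Proof. by rewrite -modzDm !padic_nextP modzDm. Qed.

Lemma padic_oppP (x : Zp) k : (- x k.+1 = - x k %[mod P k])%Z.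
Proof. by rewrite -modzNm padic_nextP modzNm. Qed.

Lemma padic_mulP (x y : Zp) k :
  (x k.+1 * y k.+1 = x k * y k %[mod P k])%Z.
Proof. by rewrite -modzMm !padic_nextP modzMm. Qed.

Definition padic_cst (a : int) : Zp := padic_of (fun k => padic_cstP a k).
Definition padic_add (x y : Zp) : Zp := padic_of (padic_addP x y).
Definition padic_opp (x : Zp) : Zp := padic_of (padic_oppP x).
Definition padic_mul (x y : Zp) : Zp := padic_of (padic_mulP x y).

Fact padic_addA : associative padic_add.
Proof.
by move=> x y z; apply: padic_eqP => k /=; rewrite !modz_mod modzDml modzDmr addrA.
Qed.

Fact padic_addC : commutative padic_add.
Proof. by move=> x y; apply: padic_eqP => k /=; rewrite addrC. Qed.

Fact padic_add0 : left_id (padic_cst 0) padic_add.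
Proof. by move=> x; apply: padic_eqP => k /=; rewrite mod0z add0r modz_mod. Qed.

Fact padic_addN : left_inverse (padic_cst 0) padic_opp padic_add.
Proof. by move=> x; apply: padic_eqP => k /=; rewrite modzDml addNr modz_mod. Qed.

HB.instance Definition _ :=
  GRing.isZmodule.Build Zp padic_addA padic_addC padic_add0 padic_addN.

Fact padic_mulA : associative padic_mul.
Proof.
by move=> x y z; apply: padic_eqP => k /=; rewrite !modz_mod modzMml modzMmr mulrA.
Qed.

Fact padic_mulC : commutative padic_mul.
Proof. by move=> x y; apply: padic_eqP => k /=; rewrite mulrC. Qed.

Fact padic_mul1 : left_id (padic_cst 1) padic_mul.
Proof. by move=> x; apply: padic_eqP => k /=; rewrite modzMml mul1r modz_mod. Qed.

Fact padic_mulDl : left_distributive padic_mul padic_add.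
Proof.
move=> x y z; apply: padic_eqP => k /=.
by rewrite !modz_mod modzMml modzDm mulrDl.
Qed.

Fact padic_1neq0 : padic_cst 1 != 0.
Proof.
apply/eqP => /(congr1 (fun x : Zp => x 1%N)) /=.
by rewrite expn1 mod0z modz_small // ltz_nat prime_gt1.
Qed.

HB.instance Definition _ := GRing.Zmodule_isComNzRing.Build Zp
  padic_mulA padic_mulC padic_mul1 padic_mulDl padic_1neq0.

Definition padic_unit (x : Zp) : bool := `[< exists y : Zp, y * x = 1 >].

Definition padic_inv (x : Zp) : Zp :=
  if pselect (exists y : Zp, y * x = 1) is left h then projT1 (cid h) else x.

Fact padic_mulVx : {in padic_unit, left_inverse 1 padic_inv *%R}.
Proof.
move=> x /asboolP xu; rewrite /padic_inv.
by case: pselect => // h; case: cid.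
Qed.

Fact padic_unitPl (x y : Zp) : y * x = 1 -> padic_unit x.
Proof. by move=> yx; apply/asboolP; exists y. Qed.

Fact padic_invr_out : {in [predC padic_unit], padic_inv =1 id}.
Proof.
move=> x; rewrite inE => /asboolP xu; rewrite /padic_inv.
by case: pselect.
Qed.

HB.instance Definition _ := GRing.ComNzRing_hasMulInverse.Build Zp
  padic_mulVx padic_unitPl padic_invr_out.

Lemma padic_resD (x : Zp) k j : (x (k + j)%N = x k %[mod P k])%Z.
Proof.
elim: j => [|j IHj]; first by rewrite addn0.
by rewrite addnS -IHj -[in RHS](padic_resP x) modz_pow.
Qed.

Lemma padic_neq0 (x : Zp) : x != 0 ->
  exists k, forall j, ~~ (p ^ k %| `|x (k + j)%N|)%N.
Proof.
move=> x0; apply: contrapT => noP; case/eqP: x0; apply: padic_eqP => k /=.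
rewrite !mod0z; apply: contrapT => xk; apply: noP; exists k => j.
apply/negP => xkj; apply: xk; rewrite -(padic_resD x k j).
exact: (dvdz_mod0P (d := P k) xkj).
Qed.

Fact padic_mulf_eq0 : GRing.integral_domain_axiom Zp.
Proof.
move=> x y xy; apply: contrapT => /negP; rewrite negb_or => /andP[].
move=> /padic_neq0[k xk] /padic_neq0[j yj].
have {xk} := xk j; have {yj} := yj k; rewrite (addnC j).
have : (P (k + j)%N %| x (k + j)%N * y (k + j)%N)%Z.
  have := congr1 (fun z : Zp => z (k + j)%N) xy; rewrite /= mod0z.
  by move/dvdz_mod0P.
rewrite dvdzE abszM /=; move: `|x _|%N `|y _|%N => a b {x y xy}.
case: a => [|a]; first by rewrite dvdn0.
case: b => [|b]; first by rewrite dvdn0.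
by rewrite !pfactor_dvdn // lognM // => abP bP aP; move: abP bP aP; lia.
Qed.

HB.instance Definition _ := GRing.ComUnitRing_isIntegral.Build Zp padic_mulf_eq0.

End PadicInt.

Definition padic_rat (p : nat) (p_pr : prime p) := {fraction padic_int p_pr}.

HB.instance Definition _ p p_pr := GRing.Field.on (@padic_rat p p_pr).

Section RingOfIntegers.

Variables (p : nat) (p_pr : prime p) (K : fieldExtType (padic_rat p_pr)).

Definition padic_embed : padic_int p_pr -> K := in_alg K \o @tofrac _.

HB.instance Definition _ :=
  GRing.RMorphism.copy padic_embed (in_alg K \o @tofrac _).

Definition is_integral : {pred K} := fun u => `[< integralOver padic_embed u >].

Fact is_integral_subring : subring_closed is_integral.
Proof.
split=> [|u v /asboolP iu /asboolP iv|u v /asboolP iu /asboolP iv].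
- by apply/asboolP; apply: integral1.
- by apply/asboolP; apply: integral_sub.
- by apply/asboolP; apply: integral_mul.
Qed.

HB.instance Definition _ :=
  GRing.isSubringClosed.Build K is_integral is_integral_subring.

(* The integral closure of Z_p in the finite extension K of Q_p. *)
Record integers := Integers {
  integers_val :> K;
  integers_valP : integers_val \in is_integral
}.

HB.instance Definition _ := [isSub for integers_val].
HB.instance Definition _ := [Choice of integers by <:].
HB.instance Definition _ := [SubChoice_isSubComNzRing of integers by <:].

(* pi identifies the quotient of the ring of integers by p with F.  As F is a
   field, p then generates the maximal ideal, so K is unramified over Q_p; it
   is the extension Q_q with q = #|F|, unique up to isomorphism. *)
Definition is_reduction (F : finFieldType) (pi : {rmorphism integers -> F}) :=
  (forall y, exists u, pi u = y) /\
  (forall u, pi u = 0 <-> exists v, u = p%:R * v).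

End RingOfIntegers.

Section Dynamics.

Variable n : nat.
Implicit Types Phi Psi : n.-tuple {mpoly int[n]}.

Definition pmap_comp Phi Psi : n.-tuple {mpoly int[n]} :=
  [tuple tnth Phi i \mPo Psi | i < n].

Definition pmap_iter Phi m : n.-tuple {mpoly int[n]} :=
  iter m (pmap_comp Phi) [tuple 'X_i | i < n].

Definition pmap_eval Phi (R : comNzRingType) (X : n.-tuple R) : n.-tuple R :=
  [tuple (map_mpoly intr (tnth Phi i)).@[tnth X] | i < n].

Definition is_ideal (I : {mpoly int[n]} -> Prop) :=
  [/\ I 0, forall f g, I f -> I g -> I (f + g) & forall h f, I f -> I (h * f)].

Definition image_ideal Phi : {mpoly int[n]} -> Prop :=
  fun f => f \mPo pmap_iter Phi n = 0.

Definition zero_locus (I : {mpoly int[n]} -> Prop) (R : comNzRingType)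
    (X : n.-tuple R) :=
  forall f, I f -> (map_mpoly intr f).@[tnth X] = 0.

(* Closed subschemes of affine space over Z correspond bijectively to ideals,
   reversing inclusions; J may be the unit ideal (the empty subscheme). *)
Definition proper_closed_subscheme (J I : {mpoly int[n]} -> Prop) :=
  [/\ is_ideal J, forall f, I f -> J f & exists2 f, J f & ~ I f].

Definition congr_mod (R : comNzRingType) (d : nat) (X Y : n.-tuple R) :=
  forall i, exists c, tnth X i - tnth Y i = d%:R * c.

(* U is a neighbourhood of X for the topology induced on the subset S. *)
Definition padic_nbhd (R : comNzRingType) (p : nat) (S : n.-tuple R -> Prop)
    (X : n.-tuple R) (U : n.-tuple R -> Prop) :=
  exists k, forall Y, S Y -> congr_mod (p ^ k) Y X -> U Y.

End Dynamics.

Definition syndetic (S : nat -> Prop) :=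
  exists L, forall m, exists2 j, (j <= L)%N & S (m + j)%N.

Definition uniformly_recurrent (T : Type) (nbhd : T -> (T -> Prop) -> Prop)
    (f : T -> T) (x : T) :=
  forall U, nbhd x U -> syndetic (fun m => U (iter m f x)).

(* Main.v *)
(* Write psi f for f o Phi, so that the ideal of V is ker psi^n.  The kernels
   ker psi^j stabilize at j = n (a chain of primes in n variables), so for each i
   a relation Q_i of minimal degree between the i-th coordinates of
   Phi^n, ..., Phi^2n descends to V; its derivative in the first variable involved
   is a function h_i on V, and Phi is unramified on V where all h_i are nonzero.

   Existence of x with Phi(x) = x^p (p-th powers of the coordinates) off a given
   D not in the ideal of V, following Borisov and Sapir: let J be generated by the
   X_i^p - Phi_i.  Modulo J the i-th coordinate of Phi^j is X_i^(p^j), so Q_i gives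
   a one-variable polynomial of degree at most C p^n killing X_i^(p^n), with C
   independent of p.  If D vanished at all such x in a large finite field of order
   q, the finite-field Nullstellensatz would put D in J + (X_i^q - X_i), hence a
   power of D o Phi^2n whose exponent does not depend on p in J; but J contains no
   nonzero polynomial of degree less than p.

   Taking D divisible by the h_i, the differential of Phi is injective on the
   tangent spaces (over a finite field) of V along the periodic orbit of x, so the
   differential of some Phi^a is the identity on T_x V.  For points X, Y of V over
   x with X = Y mod p^k, Taylor's formula gives
   Phi^a(X) - Phi^a(Y) = X - Y mod p^(k+1), and the congruence follows by
   induction on k. *)

Require Import Defs.
From HB Require Import structures.
From mathcomp Require Import all_boot all_order all_algebra all_field.
From mathcomp Require Import boolp.
From mathcomp Require Import mpoly.
From mathcomp Require Import zify ring.

Set Implicit Arguments.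
Unset Strict Implicit.
Unset Printing Implicit Defensive.

Import GRing.Theory Num.Theory.
Local Open Scope ring_scope.

(** * Evaluation of integer polynomials and iterates *)

Lemma mpoly_ring_ind n (R : comNzRingType) (P : {mpoly R[n]} -> Prop) :
  (forall c, P c%:MP) -> (forall i, P 'X_i) ->
  (forall f g, P f -> P g -> P (f + g)) ->
  (forall f g, P f -> P g -> P (f * g)) -> forall f, P f.
Proof.
move=> PC PX PD PM; elim/mpolyind => [|c m f _ _ Pf]; first exact: (PC 0).
apply: (PD) => //; rewrite -mul_mpolyC; apply: (PM) => //.
rewrite mpolyXE_id; apply: big_ind => //; first exact: (PC 1).
by move=> i _; elim: (m i) => [|k IHk]; [exact: (PC 1) | rewrite exprS; exact: PM].
Qed.

(** Serves at once for values at points, substitution of polynomials and reduction of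
    coefficients. *)
HB.lock Definition ev n (R : comNzRingType) (v : 'I_n -> R) (f : {mpoly int[n]}) : R :=
  (map_mpoly (intr : int -> R) f).@[v].

Fact ev_is_zmod_morphism n (R : comNzRingType) (v : 'I_n -> R) : zmod_morphism (ev v).
Proof. by move=> f g; rewrite ev.unlock rmorphB mevalB. Qed.

Fact ev_is_monoid_morphism n (R : comNzRingType) (v : 'I_n -> R) :
  monoid_morphism (ev v).
Proof. by split=> [|f g]; rewrite ev.unlock ?rmorph1 ?meval1 ?rmorphM ?mevalM. Qed.

HB.instance Definition _ n (R : comNzRingType) (v : 'I_n -> R) :=
  GRing.isZmodMorphism.Build {mpoly int[n]} R (ev v) (ev_is_zmod_morphism v).
HB.instance Definition _ n (R : comNzRingType) (v : 'I_n -> R) :=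
  GRing.isMonoidMorphism.Build {mpoly int[n]} R (ev v) (ev_is_monoid_morphism v).

Lemma evX n (R : comNzRingType) (v : 'I_n -> R) i : ev v 'X_i = v i.
Proof. by rewrite ev.unlock map_mpolyX mevalXU. Qed.

Lemma evB n (R : comNzRingType) (v : 'I_n -> R) : {morph ev v : f g / f - g}.
Proof. exact: rmorphB. Qed.

Lemma rmorph_mpolyC n (R : nzRingType) (h : {rmorphism {mpoly int[n]} -> R}) c :
  h c%:MP = c%:~R.
Proof. by rewrite -[c in LHS]intz !rmorph_int. Qed.

Lemma mpolyC_int n (c : int) : c%:MP_[n] = c%:~R :> {mpoly int[n]}.
Proof. exact: (rmorph_mpolyC idfun). Qed.

Lemma evC n (R : comNzRingType) (v : 'I_n -> R) c : ev v c%:MP = c%:~R.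
Proof. exact: rmorph_mpolyC. Qed.

(** The integer polynomial ring is the free commutative ring on its variables, so identities between
    ring morphisms out of it can be checked on the variables. *)
Lemma ev_unique n (R : comNzRingType) (h : {rmorphism {mpoly int[n]} -> R}) f :
  h f = ev (fun i => h 'X_i) f.
Proof.
elim/(@mpoly_ring_ind n): f => [c|i|f g IHf IHg|f g IHf IHg].
- by rewrite evC rmorph_mpolyC.
- by rewrite evX.
- by rewrite !rmorphD IHf IHg.
- by rewrite !rmorphM IHf IHg.
Qed.

Lemma eq_ev n (R : comNzRingType) (u v : 'I_n -> R) f : u =1 v -> ev u f = ev v f.
Proof. by move=> uv; rewrite ev.unlock; apply: meval_eq. Qed.

Lemma rmorph_ev n (R S : comNzRingType) (h : {rmorphism R -> S})
    (v : 'I_n -> R) f : h (ev v f) = ev (h \o v) f.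
Proof.
rewrite -[LHS]/((h \o ev v) f) ev_unique; apply: eq_ev => i /=.
by rewrite evX.
Qed.

Lemma ev_id n f : ev (fun i => 'X_i) f = f :> {mpoly int[n]}.
Proof. by rewrite -[RHS]/(idfun f) [RHS]ev_unique. Qed.

Lemma map_mpoly_ev n (R : comNzRingType) (f : {mpoly int[n]}) :
  map_mpoly (intr : int -> R) f = ev (fun i => 'X_i) f.
Proof. by rewrite ev_unique; apply: eq_ev => i; rewrite /= map_mpolyX. Qed.

Lemma comp_mpoly_ev n k (f : {mpoly int[n]}) (t : n.-tuple {mpoly int[k]}) :
  f \mPo t = ev (tnth t) f.
Proof.
rewrite -[LHS]/((comp_mpoly t) f) ev_unique; apply: eq_ev => i /=.
by rewrite comp_mpolyXU -tnth_nth.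
Qed.

Lemma ev_ev n k (R : comNzRingType) (v : 'I_k -> R) (f : {mpoly int[n]})
    (t : 'I_n -> {mpoly int[k]}) :
  ev v (ev t f) = ev (fun i => ev v (t i)) f.
Proof. exact: rmorph_ev. Qed.

Definition orbit_poly n (Phi : n.-tuple {mpoly int[n]}) j i : {mpoly int[n]} :=
  tnth (pmap_iter Phi j) i.

(** The endomorphism psi^j of the outline; the ideal of V is the kernel of [pull n]. *)
HB.lock Definition pull n (Phi : n.-tuple {mpoly int[n]}) j (f : {mpoly int[n]}) :
  {mpoly int[n]} := f \mPo pmap_iter Phi j.

Section Pull.

Variables (n : nat) (Phi : n.-tuple {mpoly int[n]}).
Local Notation pull := (pull Phi).
Local Notation orbit_poly := (orbit_poly Phi).

Lemma pullE j f : pull j f = ev (orbit_poly j) f.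
Proof. by rewrite pull.unlock comp_mpoly_ev. Qed.

Fact pull_is_zmod_morphism j : zmod_morphism (pull j).
Proof. by move=> f g; rewrite !pullE rmorphB. Qed.

Fact pull_is_monoid_morphism j : monoid_morphism (pull j).
Proof. by split=> [|f g]; rewrite !pullE ?rmorph1 ?rmorphM. Qed.

HB.instance Definition _ j :=
  GRing.isZmodMorphism.Build {mpoly int[n]} {mpoly int[n]} (pull j)
    (pull_is_zmod_morphism j).
HB.instance Definition _ j :=
  GRing.isMonoidMorphism.Build {mpoly int[n]} {mpoly int[n]} (pull j)
    (pull_is_monoid_morphism j).

Lemma pullB j : {morph pull j : f g / f - g}.
Proof. exact: rmorphB. Qed.

Lemma orbit_poly0 i : orbit_poly 0 i = 'X_i.
Proof. by rewrite /orbit_poly tnth_mktuple. Qed.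

Lemma orbit_polyS j i : orbit_poly j.+1 i = pull j (tnth Phi i).
Proof. by rewrite pull.unlock /orbit_poly tnth_mktuple. Qed.

Lemma pull0 f : pull 0 f = f.
Proof. by rewrite pullE -[RHS]ev_id; apply: eq_ev => i; rewrite orbit_poly0. Qed.

Lemma pull_add j k f : pull j (pull k f) = pull (k + j) f.
Proof.
elim: k f => [|k IHk] f; first by rewrite pull0.
have pullS m g : pull m.+1 g = pull m (pull 1 g).
  rewrite !(pullE _ g) rmorph_ev; apply: eq_ev => i /=.
  by rewrite !orbit_polyS pull0.
by rewrite addSn pullS [RHS]pullS IHk.
Qed.

Lemma pull_orbit j k i : pull j (orbit_poly k i) = orbit_poly (k + j) i.
Proof.
have pullX m : orbit_poly m i = pull m 'X_i by rewrite pullE evX.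
by rewrite !pullX pull_add.
Qed.

Lemma ev_pull (R : comNzRingType) (v : 'I_n -> R) j f :
  ev v (pull j f) = ev (fun i => ev v (orbit_poly j i)) f.
Proof. by rewrite pullE rmorph_ev. Qed.

End Pull.

(** * Algebraic dependence and stabilization of kernels *)

Section AlgebraicDependence.

Lemma clear_denominators r (u : 'I_r -> rat) :
  exists2 d : int, d != 0 & exists w : 'I_r -> int, forall i, d%:~R * u i = (w i)%:~R.
Proof.
exists (\prod_i denq (u i)); first by apply/prodf_neq0 => i _; apply: denq_neq0.
exists (fun i => numq (u i) * \prod_(j | j != i) denq (u j)) => i.
rewrite (bigD1 i) //= [RHS]rmorphM [in LHS]rmorphM /= mulrAC; congr (_ * _).
by rewrite -[X in _ * X]divq_num_den mulrC divfK // intr_eq0 denq_neq0.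
Qed.

Lemma int_row_kernel (I J : finType) (A : I -> J -> int) : (#|J| < #|I|)%N ->
  exists2 w : I -> int, exists i, w i != 0 & forall j, \sum_i w i * A i j = 0.
Proof.
move=> ltJI.
pose B : 'M[rat]_(#|I|, #|J|) := \matrix_(i, j) (A (enum_val i) (enum_val j))%:~R.
have : kermx B != 0.
  rewrite kermx_eq0 /row_free neq_ltn.
  by rewrite (leq_ltn_trans (rank_leq_col B)).
case/rowV0Pn=> u /sub_kermxP uB u0.
have [d d0 [w wP]] := clear_denominators (fun i => u 0 i).
exists (fun i => w (enum_rank i)) => [|j].
  have [i ui] : exists i, u 0 i != 0.
    apply/existsP; apply: contraNT u0 => /existsPn u0.
    by apply/eqP/rowP => i; rewrite mxE; apply/eqP; have := u0 i; rewrite negbK.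
  exists (enum_val i); rewrite enum_valK.
  by have := wP i; apply: contra_eq_neq => ->; rewrite mulf_neq0 ?intr_eq0.
apply/eqP; rewrite -(intr_eq0 rat) rmorph_sum /=.
have /rowP/(_ (enum_rank j)) := uB; rewrite !mxE => uBj.
apply/eqP; rewrite -[RHS](mulr0 d%:~R) -[X in _ = _ * X]uBj.
rewrite mulr_sumr (reindex (@enum_rank I)) /=; last first.
  by exists enum_val => ? _; rewrite ?enum_rankK ?enum_valK.
apply: eq_bigr => i _.
by rewrite [LHS]intrM -wP mxE !enum_rankK mulrA.
Qed.

Lemma msizeM_leq n (R : nzRingType) (f g : {mpoly R[n]}) :
  (msize (f * g) <= (msize f + msize g).-1)%N.
Proof.
have [->|f0] := eqVneq f 0; first by rewrite mul0r msize0.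
have [->|g0] := eqVneq g 0; first by rewrite mulr0 msize0.
have [->|fg0] := eqVneq (f * g) 0; first by rewrite msize0.
rewrite -!mlead_deg // addSn addnS /= ltnS -mdegD.
exact/lemc_mdeg/mleadM_le.
Qed.

Lemma msize_prodX_le n (R : comNzRingType) k (a : 'I_k -> {mpoly R[n]}) d N
    (al : 'I_k -> nat) :
  (forall i, msize (a i) <= d)%N -> (forall i, al i < N)%N ->
  (msize (\prod_i a i ^+ al i) <= 1 + k * (d.+1 * N))%N.
Proof.
move=> ad alN.
have msizeX i m : (msize (a i ^+ m) <= 1 + m * d)%N.
  elim: m => [|m IHm]; first by rewrite expr0 msize1.
  rewrite exprS; apply: leq_trans (msizeM_leq _ _) (leq_trans (leq_pred _) _).
  by rewrite mulSn addnCA leq_add.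
rewrite -[k in (k * _)%N]card_ord -sum_nat_const.
elim/big_rec2: _ => [|i e f _ IHf]; first by rewrite msize1.
apply: leq_trans (msizeM_leq _ _) (leq_trans (leq_pred _) _).
rewrite addnCA leq_add //.
apply: leq_trans (msizeX _ _) _.
by rewrite mulSn leq_add // ?(leq_trans _ (alN i)) // mulnC leq_mul // ltnW.
Qed.

(** By counting: the [N ^ n.+1] products of powers of the [a i] with exponents below [N] outnumber
    the monomials that can occur in them. *)
Lemma alg_dependence n (a : 'I_n.+1 -> {mpoly int[n]}) :
  exists2 Q : {mpoly int[n.+1]}, Q != 0 & ev a Q = 0.
Proof.
pose d := (\max_i msize (a i))%N.
have ad i : (msize (a i) <= d)%N by apply: leq_bigmax.
(* All exponents occurring in such a product are below [M = e * N], and [N > e ^ n] makes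
   [M ^ n < N ^ n.+1]. *)
pose e := (1 + n.+1 * d.+1)%N; pose N := (e ^ n).+1; pose M := (e * N)%N.
pose I := {ffun 'I_n.+1 -> 'I_N}; pose J := {ffun 'I_n -> 'I_M}.
pose mnmI (al : I) := [multinom (al i : nat) | i < n.+1].
pose mnmJ (be : J) := [multinom (be i : nat) | i < n].
pose F (al : I) := \prod_i a i ^+ al i.
have Fsize al : (msize (F al) <= M)%N.
  apply: (leq_trans (msize_prodX_le ad (fun i => ltn_ord (al i)))).
  by rewrite /M /e mulnDl mul1n mulnA leq_add2r.
have ltJI : (#|J| < #|I|)%N.
  by rewrite !card_ffun !card_ord expnMn [in X in (_ < X)%N]expnS ltn_pmul2r ?expn_gt0.
have [w [al0 w0] wP] := int_row_kernel (fun al be => (F al)@_(mnmJ be)) ltJI.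
exists (\sum_al w al *: 'X_[mnmI al]).
  apply: contra_neq w0 => /(congr1 (mcoeff (mnmI al0))).
  rewrite mcoeff0 raddf_sum (bigD1 al0) //= mcoeffZ mcoeffX eqxx mulr1.
  rewrite big1 ?addr0 // => al neq_al; rewrite mcoeffZ mcoeffX.
  case: eqP => [/mnmP eq_al | _]; last by rewrite mulr0.
  by case/eqP: neq_al; apply/ffunP => i; apply/val_inj; have := eq_al i; rewrite !mnmE.
have -> : ev a (\sum_al w al *: 'X_[mnmI al]) = \sum_al w al *: F al.
  rewrite raddf_sum; apply: eq_bigr => al _ /=.
  rewrite -mul_mpolyC rmorphM /= evC mpolyXE_id rmorph_prod /=.
  rewrite -mul_mpolyC -[w al in RHS]intz rmorph_int; congr (_ * _).
  by apply: eq_bigr => i _; rewrite rmorphXn /= evX mnmE.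
apply/mpolyP => m; rewrite mcoeff0 raddf_sum /=.
have [/forallP mM|/forallPn[i]] := boolP [forall i, m i < M]%N.
  rewrite -[RHS](wP [ffun i => Ordinal (mM i)]); apply: eq_bigr => al _.
  rewrite mcoeffZ; congr (_ * _@__); apply/mnmP => j.
  by rewrite mnmE ffunE.
rewrite -leqNgt => leMm; apply: big1 => al _; rewrite mcoeffZ.
rewrite memN_msupp_eq0 ?mulr0 //; apply: msize_mdeg_ge.
by apply: leq_trans (Fsize al) (leq_trans leMm _); rewrite mdegE (bigD1 i) //= leq_addr.
Qed.

End AlgebraicDependence.

Section Support.

Variable n : nat.
Implicit Type f : {mpoly int[n]}.

Lemma evE (R : comNzRingType) (v : 'I_n -> R) f :
  ev v f = \sum_(m <- msupp f) (f@_m)%:~R * \prod_i v i ^+ m i.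
Proof.
rewrite {1}[f]mpolyE rmorph_sum; apply: eq_bigr => m _ /=.
rewrite -mul_mpolyC rmorphM /= evC mpolyXE_id rmorph_prod; congr (_ * _).
by apply: eq_bigr => i _; rewrite rmorphXn /= evX.
Qed.

Lemma eq_ev_supp (R : comNzRingType) (u v : 'I_n -> R) f :
  (forall m i, m \in msupp f -> m i != 0%N -> u i = v i) -> ev u f = ev v f.
Proof.
move=> uv; rewrite !evE; apply: eq_big_seq => m fm; congr (_ * _).
apply: eq_bigr => i _; have [->//|mi] := eqVneq (m i) 0%N.
by rewrite (uv m).
Qed.

Definition mfilter (P : pred 'X_{1..n}) f : {mpoly int[n]} :=
  \sum_(m <- msupp f | P m) f@_m *: 'X_[m].

Lemma mcoeff_mfilter P f m : (mfilter P f)@_m = if P m then f@_m else 0.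
Proof.
rewrite /mfilter raddf_sum /= (eq_bigr (fun k => f@_k *+ (k == m))); last first.
  by move=> k _; rewrite mcoeffZ mcoeffX mulr_natr.
rewrite -big_filter; case: ifP => Pm; last first.
  rewrite big_seq big1 // => k; rewrite mem_filter => /andP[Pk _].
  by case: eqP Pk => [->|//]; rewrite Pm.
have [fm|fm] := boolP (m \in msupp f).
  rewrite (bigD1_seq m) ?mem_filter ?Pm ?filter_uniq //= eqxx mulr1n.
  by rewrite big1 ?addr0 // => k /negPf->.
rewrite (memN_msupp_eq0 fm) big_seq big1 // => k; rewrite mem_filter => /andP[_ fk].
by case: eqP fk => [->|//]; rewrite (negPf fm).
Qed.

Lemma mfilterC P f : mfilter P f + mfilter (predC P) f = f.
Proof.
apply/mpolyP => m; rewrite mcoeffD !mcoeff_mfilter /=.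
by case: (P m); rewrite ?addr0 ?add0r.
Qed.

Lemma mpoly_divX f i : (forall m, m \in msupp f -> m i != 0%N) ->
  exists g, f = g * 'X_i.
Proof.
move=> fi; exists (\sum_(m <- msupp f) f@_m *: 'X_[m - U_(i)]).
rewrite [LHS]mpolyE mulr_suml; apply: eq_big_seq => m fm.
by rewrite -scalerAl -mpolyXD submK // lep1mP fi.
Qed.

Lemma ev_divX_eq0 (R : comNzRingType) (v : 'I_n -> R) f i :
  (forall m, m \in msupp f -> m i != 0%N) -> v i = 0 -> ev v f = 0.
Proof. by case/mpoly_divX=> g -> vi; rewrite rmorphM /= evX vi mulr0. Qed.

End Support.

(** * Stabilization of the kernels of the iterates *)

Section Stability.

Variables (n : nat) (Phi : n.-tuple {mpoly int[n]}).
Local Notation pull := (pull Phi).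

(* Specializing a relation between the [h o Phi^(n-j)] by [Phi^j] kills the
   terms in which the variable of index [j] does not have minimal exponent. *)
Lemma pull_stable h : pull n.+1 h = 0 -> pull n h = 0.
Proof.
move=> h0; apply: contrapT => /eqP b0.
(* The order is reversed so that [pull j] sends [a j] to the nonzero [pull n h], while [pull j.+1]
   sends it to [pull n.+1 h = 0]. *)
pose a (j : 'I_n.+1) := pull (n - j) h.
have [Q0 Q00 aQ0] := alg_dependence a.
(* Removing the variables one by one ends, at [j = n.+1], with a nonzero constant that vanishes. *)
pose killed j (Q : {mpoly int[n.+1]}) := [/\ Q != 0,
  forall m (i : 'I_n.+1), m \in msupp Q -> (i < j)%N -> m i = 0%N
  & pull j (ev a Q) = 0].
suff killedS j : (j < n.+1)%N -> (exists Q, killed j Q) -> exists Q, killed j.+1 Q.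
  have [Q [Q_neq0 Qvar Q_eq0]] : exists Q, killed n.+1 Q.
    suff killed_le j : (j <= n.+1)%N -> exists Q, killed j Q by exact: killed_le.
    elim: j => [_|j IHj ltj]; first by exists Q0; split => //; rewrite aQ0 rmorph0.
    exact: killedS ltj (IHj (ltnW ltj)).
  have Q1 : Q = (Q@_0)%:MP.
    apply/mpolyP => m; rewrite mcoeffC; have [<-|m0] := eqVneq 0%MM m.
      by rewrite mulr1.
    rewrite mulr0; apply: memN_msupp_eq0; apply: contra m0 => Qm.
    by apply/eqP/mnmP => i; rewrite mnm0E (Qvar m).
  move: Q_eq0; rewrite Q1 evC rmorph_int -mpolyC_int => /eqP.
  by rewrite /= mpolyC_eq0 => /eqP Qc; rewrite Q1 Qc mpolyC0 eqxx in Q_neq0.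
move=> ltjn [Q kQ]; pose oj := Ordinal ltjn.
have a_j : pull j (a oj) = pull n h by rewrite pull_add subnK.
have a_jS : pull j.+1 (a oj) = 0 by rewrite pull_add addnS subnK.
(* The terms without the variable [oj] are kept: [m0] is one of them, and the others are multiples
   of that variable and die under [pull j.+1]. *)
have zero_exp P m0 : killed j P -> m0 \in msupp P -> m0 oj = 0%N ->
    exists Q, killed j.+1 Q.
  case=> P_neq0 Pvar P_eq0 Pm0 m0j; pose C (m : 'X_{1..n.+1}) := m oj == 0%N.
  exists (mfilter C P); split.
  - apply/eqP => /(congr1 (mcoeff m0)); rewrite mcoeff_mfilter /C m0j eqxx mcoeff0.
    by apply/eqP; rewrite -mcoeff_msupp.
  - move=> m i; rewrite mcoeff_msupp mcoeff_mfilter; case: ifP; last by rewrite eqxx.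
    move=> /eqP Cm; rewrite -mcoeff_msupp => Pm; rewrite ltnS leq_eqVlt.
    case/orP=> [/eqP ij|]; last exact: Pvar.
    by rewrite -Cm; congr (m _); apply: val_inj.
  - have -> : mfilter C P = P - mfilter (predC C) P.
      by rewrite -[in X in X - _](mfilterC C P) addrK.
    rewrite evB pullB.
    have -> : pull j.+1 (ev a P) = pull 1 (pull j (ev a P)).
      by rewrite pull_add addn1.
    rewrite P_eq0 rmorph0 sub0r rmorph_ev (@ev_divX_eq0 _ _ _ _ oj) ?oppr0 //.
    by move=> m; rewrite mcoeff_msupp mcoeff_mfilter /=; case: ifP; rewrite ?eqxx.
have [m0 Qm0] : exists m0, m0 \in msupp Q by exists (mlead Q); rewrite mlead_supp //; case: kQ.
(* If the variable [oj] divides every term, it can be cancelled, since its value [pull n h] is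
   nonzero in a domain; the exponent in [m0] then drops. *)
move em: (m0 oj) => e; elim: e Q m0 em kQ Qm0 => [|e IHe] Q m0 em kQ Qm0.
  exact: zero_exp kQ Qm0 em.
have [Qj|] := pselect (forall m, m \in msupp Q -> m oj != 0%N); last first.
  case/existsNP=> m /not_implyP[Qm /negP]; rewrite negbK => /eqP mj.
  exact: zero_exp kQ Qm mj.
have [P defQ] := mpoly_divX Qj.
have suppQ m : (m \in msupp P) = ((U_(oj) + m)%MM \in msupp Q).
  by rewrite !mcoeff_msupp defQ mcoeffMX.
apply: (IHe P (m0 - U_(oj))%MM); last 1 first.
- by rewrite suppQ addmC submK // lep1mP em.
- by rewrite mnmBE em mnm1E eqxx subn1.
case: kQ => Q_neq0 Qvar Q_eq0; split.
- by apply: contra_neq Q_neq0 => P0; rewrite defQ P0 mul0r.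
- move=> m i; rewrite suppQ => /Qvar Qi /Qi; rewrite mnmDE.
  by case: (m i) => // k; rewrite addnS.
- move/eqP: Q_eq0; rewrite defQ !rmorphM /= evX a_j mulf_eq0 (negPf b0) orbF.
  by move/eqP.
Qed.

Lemma pull_eq0_add j h : pull (n + j) h = 0 -> pull n h = 0.
Proof.
elim: j h => [|j IHj] h; first by rewrite addn0.
move=> h0; apply: IHj; rewrite addnC -pull_add; apply: pull_stable.
by rewrite pull_add addnS addnC -addnS.
Qed.

End Stability.

(** * Differentials and generic unramifiedness *)

Section Differential.

(** The differential of [f] at the point [v], applied to the vector [z]. *)
Definition dev n (R : comNzRingType) (v z : 'I_n -> R) (f : {mpoly int[n]}) : R :=
  \sum_i ev v f^`M(i) * z i.

Section Rules.

Variables (n : nat) (R : comNzRingType).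
Implicit Types (v z : 'I_n -> R) (f g : {mpoly int[n]}).

Lemma devD v z f g : dev v z (f + g) = dev v z f + dev v z g.
Proof. by rewrite -big_split; apply: eq_bigr => i _; rewrite mderivD rmorphD mulrDl. Qed.

Lemma devM v z f g : dev v z (f * g) = dev v z f * ev v g + ev v f * dev v z g.
Proof.
rewrite mulr_suml mulr_sumr -big_split; apply: eq_bigr => i _ /=.
by rewrite mderivM rmorphD !rmorphM mulrDl mulrAC mulrA.
Qed.

Lemma devC v z c : dev v z c%:MP = 0.
Proof. by apply: big1 => i _; rewrite mderivC rmorph0 mul0r. Qed.

Lemma dev0 v z : dev v z 0 = 0.
Proof. by apply: big1 => i _; rewrite mderiv0 rmorph0 mul0r. Qed.

Lemma devX v z i : dev v z 'X_i = z i.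
Proof.
rewrite /dev (bigD1 i) //= big1 ?addr0 => [|j neq_ji].
  by rewrite mderivX mnm1E eqxx scale1r -[X in (X - _)%MM]add0m addmK mpolyX0 rmorph1 mul1r.
by rewrite mderivX mnm1E eq_sym (negPf neq_ji) scale0r rmorph0 mul0r.
Qed.

Lemma dev_dir0 v z f : (forall i, z i = 0) -> dev v z f = 0.
Proof. by move=> z0; apply: big1 => i _; rewrite z0 mulr0. Qed.

Lemma dev_dirB v z z' f : dev v (fun i => z i - z' i) f = dev v z f - dev v z' f.
Proof. by rewrite -sumrB; apply: eq_bigr => i _; rewrite mulrBr. Qed.

Lemma eq_dev v v' z z' f : v =1 v' -> z =1 z' -> dev v z f = dev v' z' f.
Proof. by move=> vv' zz'; apply: eq_bigr => i _; rewrite zz' (eq_ev _ vv'). Qed.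

Lemma rmorph_dev (S : comNzRingType) (h : {rmorphism R -> S}) v z f :
  h (dev v z f) = dev (h \o v) (h \o z) f.
Proof.
rewrite rmorph_sum; apply: eq_bigr => i _ /=.
by rewrite rmorphM rmorph_ev.
Qed.

(** Only the existence of a quadratic remainder is claimed, so induction on the construction of [f]
    works over every commutative ring, without division. *)
Lemma ev_taylor v z c f :
  exists r, ev (fun i => v i + c * z i) f = ev v f + c * dev v z f + c ^+ 2 * r.
Proof.
elim/(@mpoly_ring_ind n): f => [a|i|f g [r IHf] [s IHg]|f g [r IHf] [s IHg]].
- by exists 0; rewrite !evC devC !mulr0 !addr0.
- by exists 0; rewrite !evX devX mulr0 addr0.
- by exists (r + s); rewrite !rmorphD /= devD IHf IHg; ring.
- exists (dev v z f * dev v z g + r * (ev v g + c * dev v z g + c ^+ 2 * s)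
          + (ev v f + c * dev v z f) * s).
  by rewrite !rmorphM /= devM IHf IHg; ring.
Qed.

End Rules.

Lemma dev_comp n k (R : comNzRingType) (v z : 'I_k -> R)
    (t : 'I_n -> {mpoly int[k]}) (f : {mpoly int[n]}) :
  dev v z (ev t f) = dev (fun i => ev v (t i)) (fun i => dev v z (t i)) f.
Proof.
elim/(@mpoly_ring_ind n): f => [c|i|f g IHf IHg|f g IHf IHg].
- by rewrite evC -mpolyC_int !devC.
- by rewrite evX devX.
- by rewrite rmorphD !devD IHf IHg.
- by rewrite rmorphM !devM IHf IHg !ev_ev.
Qed.

End Differential.

(** * Minimal relations between iterates and their derivatives *)

Section MinimalRelation.

Variables (n : nat) (Phi : n.-tuple {mpoly int[n]}).
Local Notation pull := (pull Phi).
Local Notation orbit_poly := (orbit_poly Phi).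

(** Minimality serves for partial derivatives: a nonzero one has smaller degree, so it cannot vanish
    at [a]. *)
Lemma minimal_relation k (a : 'I_k -> {mpoly int[n]}) :
  (exists2 Q : {mpoly int[k]}, Q != 0 & ev a Q = 0) ->
  exists2 Q : {mpoly int[k]}, Q != 0 /\ ev a Q = 0 &
    forall P, (msize P < msize Q)%N -> P != 0 -> ev a P != 0.
Proof.
case=> Q0 Q0_neq0 aQ0.
pose S s := `[< exists2 Q : {mpoly int[k]}, Q != 0 /\ ev a Q = 0 & msize Q = s >].
have exS : exists s, S s by exists (msize Q0); apply/asboolP; exists Q0.
case: (ex_minnP exS) => s /asboolP[Q QP Qs] min_s; exists Q => // P.
rewrite Qs ltnNge => ltP P0; apply: contra ltP => /eqP aP.
by apply: min_s; apply/asboolP; exists P.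
Qed.

(* [g] is the relation [Q] shifted so that it starts at the first variable
   occurring in [Q], and [h] is its derivative in that variable. *)
Lemma orbit_relation (i : 'I_n) :
  exists2 Q : {mpoly int[n.+1]},
    Q != 0 /\ ev (fun k : 'I_n.+1 => orbit_poly (n + k) i) Q = 0 &
  exists g h, [/\ pull n g = 0, pull n h != 0 &
    forall (F : idomainType) (y z : 'I_n -> F),
      (forall j, dev y z (tnth Phi j) = 0) -> dev y z g = 0 ->
      ev y h != 0 -> z i = 0].
Proof.
set a := fun k : 'I_n.+1 => _.
have [Q [Q0 aQ] Qmin] := minimal_relation (alg_dependence a).
exists Q => //.
pose V (j : 'I_n.+1) := `[< exists2 m, m \in msupp Q & m j != 0%N >].
have [j Vj minj] : exists2 j, V j & forall k, V k -> (j <= k)%N.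
  have [j0 Vj0] : exists j, V j.
    apply: contrapT => noV; have Qc : Q = (Q@_0)%:MP.
      apply/mpolyP => m; rewrite mcoeffC; have [<-|m0] := eqVneq 0%MM m.
        by rewrite mulr1.
      rewrite mulr0; apply: memN_msupp_eq0; apply: contra m0 => Qm.
      apply/eqP/mnmP => j; rewrite mnm0E; apply/eqP; rewrite eq_sym.
      by apply: contrapT => /negP mj; apply: noV; exists j; apply/asboolP; exists m.
    move: aQ Q0; rewrite Qc evC -mpolyC_int /= => /eqP.
    by rewrite !mpolyC_eq0 => ->.
  by case: (arg_minnP (fun j : 'I_n.+1 => j : nat) Vj0) => j Vj jmin; exists j.
have /asboolP[m0 Qm0 m0j] := Vj.
have dQ0 : Q^`M(j) != 0.
  apply/eqP => /(congr1 (mcoeff (m0 - U_(j))%MM)); rewrite mcoeff0 mcoeff_mderiv.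
  by apply/eqP; rewrite submK ?lep1mP // mulrn_eq0 /= -mcoeff_msupp.
have dQsupp m : m \in msupp Q^`M(j) -> (m + U_(j))%MM \in msupp Q.
  by rewrite !mcoeff_msupp mcoeff_mderiv mulrn_eq0.
have dQ_neq0 : ev a Q^`M(j) != 0.
  apply: Qmin => //; rewrite -(mlead_deg dQ0).
  have /dQsupp/msize_mdeg_lt := mlead_supp dQ0.
  by rewrite mdegD mdeg1 addn1.
(* These are the entries of [a] before [n + j] iterations. The filler 0 below [j] is harmless: those
   variables do not occur in [Q], and 0 has zero differential. *)
pose s (k : 'I_n.+1) := if (k < j)%N then 0 else orbit_poly (k - j) i.
have pull_s (P : {mpoly int[n.+1]}) :
    (forall m k, m \in msupp P -> m k != 0%N -> (j <= k)%N) ->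
    pull (n + j) (ev s P) = ev a P.
  move=> Pj; rewrite rmorph_ev; apply: eq_ev_supp => m k /Pj Pm /Pm lejk.
  by rewrite /= /s ltnNge lejk /= pull_orbit addnCA subnK.
have Qj m k : m \in msupp Q -> m k != 0%N -> (j <= k)%N.
  by move=> Qm mk; apply: minj; apply/asboolP; exists m.
exists (ev s Q), (ev s Q^`M(j)); split.
(* [pull (n + j)] kills [ev s Q], and stabilization of the kernels brings this down to [pull n]. *)
- by apply: (@pull_eq0_add _ _ j); rewrite pull_s.
- apply: contra_neq dQ_neq0 => h0; rewrite -pull_s => [|m k /dQsupp Qm mk].
    by rewrite -pull_add h0 rmorph0.
  by apply: Qj Qm _; rewrite mnmDE addn_eq0 negb_and mk.
(* In the chain rule the entries of index above [j] are polynomials in the components of Phi, with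
   zero differential along [z]; what remains is the value of the derivative times [z i]. *)
move=> F y z dPhi; rewrite dev_comp {1}/dev (bigD1 j) //= big1 ?addr0 => [|k neq_kj].
  have sj : s j = 'X_i by rewrite /s ltnn subnn orbit_poly0.
  rewrite sj devX ev_ev => /eqP.
  by rewrite mulf_eq0 => /orP[->//|/eqP].
rewrite [dev y z (s k)](_ : _ = 0) ?mulr0 // /s.
case: ltnP => [_|lejk]; first exact: dev0.
have -> : (k - j = (k - j).-1 + 1)%N.
  by rewrite addn1 prednK // subn_gt0 ltn_neqAle lejk eq_sym neq_kj.
rewrite -pull_orbit pullE dev_comp dev_dir0 // => l.
by rewrite orbit_polyS pull0.
Qed.

End MinimalRelation.

(** * Normal forms modulo the ideal of the [X_i^p - F_i] *)

Section NormalForm.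

Variables (n p : nat) (R : comNzRingType) (F : 'I_n -> {mpoly R[n]}).
Hypotheses (p_gt0 : (0 < p)%N) (Fp : forall i, (msize (F i) <= p)%N).

(* The index [d] bounds the cofactors, not the element itself. *)
Definition graph_ideal d (h : {mpoly R[n]}) :=
  exists2 g : 'I_n -> {mpoly R[n]}, forall i, (msize (g i) <= d)%N
    & h = \sum_i g i * ('X_i ^+ p - F i).

Lemma graph_ideal0 d : graph_ideal d 0.
Proof.
exists (fun=> 0) => [i|]; first by rewrite msize0.
by rewrite big1 // => i _; rewrite mul0r.
Qed.

Lemma graph_idealD d h k : graph_ideal d h -> graph_ideal d k -> graph_ideal d (h + k).
Proof.
move=> [g gd ->] [g' gd' ->]; exists (fun i => g i + g' i) => [i|].
  by apply: leq_trans (msizeD_le _ _) _; rewrite geq_max gd gd'.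
by rewrite -big_split; apply: eq_bigr => i _; rewrite mulrDl.
Qed.

Lemma graph_idealZ d c h : graph_ideal d h -> graph_ideal d (c *: h).
Proof.
move=> [g gd ->]; exists (fun i => c *: g i) => [i|].
  exact: leq_trans (msizeZ_le _ _) (gd i).
by rewrite scaler_sumr; apply: eq_bigr => i _; rewrite scalerAl.
Qed.

Lemma graph_idealB d h k : graph_ideal d h -> graph_ideal d k -> graph_ideal d (h - k).
Proof. by move=> hd kd; rewrite -[- k]scaleN1r; apply/graph_idealD/graph_idealZ. Qed.

Lemma graph_ideal_sum d (I : eqType) (s : seq I) (h : I -> {mpoly R[n]}) :
  (forall i, i \in s -> graph_ideal d (h i)) -> graph_ideal d (\sum_(i <- s) h i).
Proof.
move=> hd; rewrite big_seq; apply: big_ind => //; first exact: graph_ideal0.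
exact: graph_idealD.
Qed.

Lemma graph_ideal_le d e h : (d <= e)%N -> graph_ideal d h -> graph_ideal e h.
Proof. by move=> de [g gd ->]; exists g => // i; apply: leq_trans (gd i) de. Qed.

Lemma graph_ideal0_eq0 h : graph_ideal 0 h -> h = 0.
Proof.
move=> [g g0 ->]; apply: big1 => i _.
by have := g0 i; rewrite leqn0 msize_poly_eq0 => /eqP->; rewrite mul0r.
Qed.

(** The case [d = 0], where the element is 0, absorbs the truncated subtractions in the bounds
    below. *)
Lemma graph_idealM d e f h : (msize f <= p)%N -> (d + p <= e + 1)%N \/ d = 0%N ->
  graph_ideal d h -> graph_ideal e (f * h).
Proof.
move=> fp [le_dp|->]; last first.
  by move/graph_ideal0_eq0=> ->; rewrite mulr0; apply: graph_ideal0.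
move=> [g gd ->]; exists (fun i => f * g i) => [i|].
  apply: leq_trans (msizeM_leq _ _) _.
  by have := gd i; move: fp le_dp; lia.
by rewrite mulr_sumr; apply: eq_bigr => i _; rewrite mulrA.
Qed.

(** A single pass: each block [X_i^p] is replaced once by [F i], and the result may again contain
    [p]-th powers. *)
Definition rewX (m : 'X_{1..n}) : {mpoly R[n]} :=
  \prod_i ('X_i ^+ (m i %% p) * F i ^+ (m i %/ p)).

Definition rew (h : {mpoly R[n]}) := \sum_(m <- msupp h) h@_m *: rewX m.

Lemma rew_sup s h : uniq s -> {subset msupp h <= s} ->
  rew h = \sum_(m <- s) h@_m *: rewX m.
Proof.
move=> uniq_s hs; rewrite [RHS](bigID (mem (msupp h))) /= [X in _ + X]big1 ?addr0.
  rewrite -big_filter; apply: perm_big; apply: uniq_perm; rewrite ?filter_uniq //.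
  by move=> m; rewrite mem_filter; case: (boolP (m \in msupp h)) => // /hs.
by move=> m /memN_msupp_eq0 ->; rewrite scale0r.
Qed.

Lemma rew_is_linear : linear rew.
Proof.
move=> c h k; pose s := undup (msupp h ++ msupp k ++ msupp (c *: h + k)).
have us : uniq s by apply: undup_uniq.
rewrite !(@rew_sup s) //; last 3 first.
- by move=> m; rewrite mem_undup !mem_cat => ->; rewrite orbT.
- by move=> m; rewrite mem_undup !mem_cat => ->.
- by move=> m; rewrite mem_undup !mem_cat => ->; rewrite !orbT.
rewrite scaler_sumr -big_split; apply: eq_bigr => m _.
by rewrite mcoeffD mcoeffZ scalerDl scalerA.
Qed.

HB.instance Definition _ :=
  GRing.isLinear.Build R {mpoly R[n]} {mpoly R[n]} _ rew rew_is_linear.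

Lemma rew_X m : rew 'X_[m] = rewX m.
Proof. by rewrite /rew msuppX big_seq1 mcoeffX eqxx scale1r. Qed.

Lemma rewXD m i : rewX (m + U_(i) *+ p) = F i * rewX m.
Proof.
rewrite /rewX (bigD1 i) //= [in RHS](bigD1 i) //= !mulrA; congr (_ * _).
  rewrite mnmDE mulmnE mnm1E eqxx mul1n modnDr divnDr // divnn p_gt0 addn1 exprS.
  by rewrite mulrCA mulrA.
apply: eq_bigr => j /negPf ji.
by rewrite mnmDE mulmnE mnm1E eq_sym ji mul0n addn0.
Qed.

Lemma rewX_reduced (m : 'X_{1..n}) : (forall i, m i < p)%N -> rewX m = 'X_[m].
Proof.
move=> mp; rewrite mpolyXE_id; apply: eq_bigr => i _.
by rewrite modn_small // divn_small // mulr1.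
Qed.

Lemma rew_reduced h : (msize h <= p)%N -> rew h = h.
Proof.
move=> hp; rewrite [RHS]mpolyE; apply: eq_big_seq => m hm; rewrite rewX_reduced // => i.
have := leq_trans (msize_mdeg_lt hm) hp; apply: leq_ltn_trans.
by rewrite mdegE (bigD1 i) //= leq_addr.
Qed.

(** Induction on the degree: trading one block [X_i^p] for [F i] costs a cofactor of degree
    [mdeg m - p] and leaves [F i] times the same problem for [m']. *)
Lemma rewX_congr m : graph_ideal ((mdeg m).+1 - p) ('X_[m] - rewX m).
Proof.
move Ed: (mdeg m) => d; elim/ltn_ind: d m Ed => d IHd m Ed.
have [/forallP mp|/forallPn[i]] := boolP [forall i, m i < p]%N.
  by rewrite rewX_reduced // subrr; apply: graph_ideal0.
rewrite -leqNgt => le_pm; pose m' := (m - U_(i) *+ p)%MM.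
have Em : m = (m' + U_(i) *+ p)%MM.
  apply/mnmP => j; rewrite mnmDE mnmBE mulmnE mnm1E.
  by case: eqP => [<-|_]; rewrite ?mul1n ?mul0n ?subnK ?subn0 ?addn0.
have Ed' : (mdeg m' + p = d)%N by rewrite -Ed Em mdegD mdegMn mdeg1 mul1n.
have -> : 'X_[m] - rewX m =
    'X_[m'] * ('X_i ^+ p - F i) + F i * ('X_[m'] - rewX m').
  by rewrite Em rewXD mpolyXD -mpolyXn; ring.
apply: graph_idealD.
  exists (fun j => if j == i then 'X_[m'] else 0) => [j|].
    by case: ifP; rewrite ?msize0 ?msizeX -?Ed' //; lia.
  rewrite (bigD1 i) //= eqxx big1 ?addr0 // => j /negPf->.
  by rewrite mul0r.
apply: (@graph_idealM ((mdeg m').+1 - p)) => //; last by apply: (IHd (mdeg m')) => //; lia.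
by lia.
Qed.

Lemma rew_congr h : graph_ideal (msize h - p) (h - rew h).
Proof.
rewrite {2}[h]mpolyE /rew -sumrB; apply: graph_ideal_sum => m hm.
rewrite -scalerBr; apply/graph_idealZ/graph_ideal_le/rewX_congr.
by rewrite leq_sub2r // msize_mdeg_lt.
Qed.

(** On a term [X^m * (X_i^p - F i)] the first half rewrites to [F i * rewX m]; comparison with the
    second half leaves a difference of two rewriting errors, whose cofactors have degree below
    [mdeg m]. *)
Lemma rew_graph_ideal d h : graph_ideal d.+1 h -> graph_ideal d (rew h).
Proof.
move=> [g gd ->]; rewrite raddf_sum; apply: graph_ideal_sum => i _ /=.
rewrite [g i]mpolyE mulr_suml raddf_sum; apply: graph_ideal_sum => m gm /=.
rewrite -scalerAl linearZ; apply: graph_idealZ.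
have lemd : (mdeg m <= d)%N by have := leq_trans (msize_mdeg_lt gm) (gd i).
rewrite mulrBr mpolyXn -mpolyXD raddfB /= rew_X rewXD.
have -> : F i * rewX m - rew ('X_[m] * F i) =
    ('X_[m] * F i - rew ('X_[m] * F i)) - F i * ('X_[m] - rewX m) by ring.
apply: graph_idealB.
  apply: graph_ideal_le (rew_congr _).
  have := msizeM_leq 'X_[R, m] (F i); rewrite msizeX.
  by have := Fp i; lia.
apply: graph_idealM (Fp i) _ (rewX_congr m).
by lia.
Qed.

(* Rewriting [X_i^p] to [F i] lowers the degree of the cofactors of a member of
   the ideal, but does not change polynomials of degree less than [p]. *)
Lemma graph_ideal_small d h : (msize h <= p)%N -> graph_ideal d h -> h = 0.
Proof.
move=> hp; elim: d => [|d IHd]; first exact: graph_ideal0_eq0.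
by move/rew_graph_ideal; rewrite rew_reduced.
Qed.

End NormalForm.

(** * Nullstellensatz over a finite field *)

Section Ideals.

Definition ideal_pred (A : comNzRingType) (I : A -> Prop) :=
  [/\ I 0, forall f g, I f -> I g -> I (f + g) & forall h f, I f -> I (h * f)].

Variables (A : comNzRingType) (I : A -> Prop).
Hypothesis idI : ideal_pred I.

Lemma ideal0 : I 0. Proof. by case: idI. Qed.

Lemma idealD f g : I f -> I g -> I (f + g).
Proof. by case: idI => _ + _; apply. Qed.

Lemma idealM h f : I f -> I (h * f).
Proof. by case: idI => _ _; apply. Qed.

Lemma idealB f g : I f -> I g -> I (f - g).
Proof. by move=> If Ig; rewrite -mulN1r; apply/idealD/idealM. Qed.

Lemma ideal_sum (T : Type) (s : seq T) (P : pred T) (f : T -> A) :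
  (forall i, P i -> I (f i)) -> I (\sum_(i <- s | P i) f i).
Proof. by move=> If; apply: big_ind => //; [exact: ideal0 | exact: idealD]. Qed.

Lemma ideal_congr f g : I (f - g) -> I g -> I f.
Proof. by move=> fg Ig; rewrite -(subrK g f); apply: idealD. Qed.

Lemma ideal_congrX f g k : I (f - g) -> I (f ^+ k - g ^+ k).
Proof. by move=> fg; rewrite subrXX mulrC; apply: idealM. Qed.

Lemma ideal_ev_congr n (u v : 'I_n -> A) f :
  (forall i, I (u i - v i)) -> I (ev u f - ev v f).
Proof.
move=> uv; elim/(@mpoly_ring_ind n): f => [c|i|f g IHf IHg|f g IHf IHg].
- by rewrite !evC subrr; apply: ideal0.
- by rewrite !evX.
- by rewrite !rmorphD opprD addrACA; apply: idealD.
- rewrite !rmorphM; have -> : ev u f * ev u g - ev v f * ev v g =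
    ev u g * (ev u f - ev v f) + ev v f * (ev u g - ev v g) by ring.
  by apply: idealD; apply: idealM.
Qed.

Lemma ideal_exprD a b j k : I (a ^+ j) -> I (b ^+ k) -> I ((a + b) ^+ (j + k)).
Proof.
move=> Ia Ib; rewrite exprDn; apply: ideal_sum => -[i lei] _ /=.
rewrite -mulr_natl; apply: idealM; have [leji|ltij] := leqP k i.
  by apply: idealM; rewrite -(subnK leji) exprD; apply: idealM.
rewrite mulrC; apply: idealM; rewrite (_ : (j + k - i = k - i + j)%N); last by lia.
by rewrite exprD; apply: idealM.
Qed.

(** The extra 1 in the exponent takes care of the empty sum, whose 0th power would be 1. *)
Lemma ideal_expr_sum (T : Type) (s : seq T) (a : T -> A) C :
  (forall i, I (a i ^+ C)) -> I ((\sum_(i <- s) a i) ^+ (size s * C).+1).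
Proof.
move=> Ia; elim: s => [|i s IHs]; first by rewrite big_nil expr1; apply: ideal0.
by rewrite big_cons /= mulSn -addnS; apply: ideal_exprD.
Qed.

End Ideals.

Section Lagrange.

Variable L : finFieldType.

Definition lagrange (c : L) : {poly L} :=
  ((\prod_(b | b != c) (c - b))^-1)%:P * \prod_(b | b != c) ('X - b%:P).

Lemma lagrange_mul c : ('X - c%:P) * lagrange c =
  ((\prod_(b | b != c) (c - b))^-1)%:P * ('X^#|L| - 'X).
Proof. by rewrite finField_genPoly [X in _ = _ * X](bigD1 c) //= mulrCA. Qed.

Lemma horner_lagrange c d : (lagrange c).[d] = (d == c)%:R.
Proof.
rewrite /lagrange hornerM hornerC horner_prod.
rewrite [X in _ * X](eq_bigr (fun b => d - b)) => [|b _]; last by rewrite hornerXsubC.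
have [->|ne_dc] := eqVneq d c.
  by rewrite mulVf //; apply/prodf_neq0 => b; rewrite subr_eq0 eq_sym.
by rewrite [X in _ * X](bigD1 d) //= subrr mul0r mulr0.
Qed.

Lemma size_lagrange c : (size (lagrange c) <= #|L|)%N.
Proof.
rewrite /lagrange mul_polyC; apply: leq_trans (size_scale_leq _ _) _.
rewrite -(@big_enum _ _ _ _ (predC1 c) (fun b => 'X - b%:P)) size_prod_XsubC -cardE.
by rewrite cardC1 prednK // (cardD1 c).
Qed.

Lemma sum_lagrange : \sum_c lagrange c = 1.
Proof.
apply/eqP; rewrite -subr_eq0; apply/eqP; set u := _ - 1.
apply: (@roots_geq_poly_eq0 _ u (enum L)); last first.
- rewrite -cardT (leq_trans (size_polyD _ _)) // geq_max size_polyN size_poly1.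
  rewrite (leq_trans (size_sum _ _ _)) ?(ltnW (finNzRing_gt1 L)) //.
  by apply/bigmax_leqP => c _; apply: size_lagrange.
- exact: enum_uniq.
apply/allP => d _; rewrite rootE hornerD hornerN hornerC horner_sum.
rewrite (bigD1 d) //= horner_lagrange eqxx big1 ?addr0 ?subrr // => c.
by rewrite horner_lagrange eq_sym => /negPf->.
Qed.

(** The products [E a] of Lagrange polynomials sum to 1, and modulo [I] each acts as the indicator
    of [a]: [f * E a] is congruent to [f(a) * E a]. Where [D(a)] is nonzero, a member of [I] not
    vanishing at [a] puts [E a] in [I]. *)
Lemma finite_nullstellensatz n (I : {mpoly L[n]} -> Prop) D :
  ideal_pred I -> (forall i, I ('X_i ^+ #|L| - 'X_i)) ->
  (forall a : 'I_n -> L, D.@[a] != 0 -> exists2 f, I f & f.@[a] != 0) -> I D.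
Proof.
move=> idI Ifield ID.
pose e i c : {mpoly L[n]} := horner_alg 'X_i (lagrange c).
pose E (a : {ffun 'I_n -> L}) := \prod_i e i (a i).
have sumE : \sum_a E a = 1.
  rewrite -(bigA_distr_bigA e) big1 // => i _.
  by rewrite -raddf_sum sum_lagrange /= rmorph1.
have E_ev f a : I (f * E a - (f.@[a])%:MP * E a).
  elim/(@mpoly_ring_ind n): f => [c|i|f g IHf IHg|f g IHf IHg].
  - by rewrite mevalC subrr; apply: ideal0.
  - rewrite mevalXU -mulrBl /E (bigD1 i) //= mulrA mulrC; apply: idealM => //.
    have -> : 'X_i - (a i)%:MP = horner_alg 'X_i ('X - (a i)%:P) :> {mpoly L[n]}.
      by rewrite rmorphB /= horner_algX horner_algC alg_mpolyC.
    rewrite -rmorphM lagrange_mul rmorphM rmorphB rmorphXn /= horner_algX.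
    exact: idealM.
  - by rewrite mevalD mpolyCD !mulrDl opprD addrACA; apply: idealD.
  - rewrite mevalM mpolyCM.
    have -> : f * g * E a - (f.@[a])%:MP * (g.@[a])%:MP * E a =
      f * (g * E a - (g.@[a])%:MP * E a)
      + (g.@[a])%:MP * (f * E a - (f.@[a])%:MP * E a) by ring.
    by apply: idealD => //; apply: idealM.
rewrite -[D]mulr1 -sumE mulr_sumr; apply: ideal_sum => // a _.
apply: ideal_congr (E_ev D a) _ => //.
have [->|Da] := eqVneq (D.@[a]) 0; first by rewrite mpolyC0 mul0r; apply: ideal0.
have [f If fa] := ID a Da.
have IfE : I ((f.@[a])%:MP * E a).
  have -> : (f.@[a])%:MP * E a = E a * f - (f * E a - (f.@[a])%:MP * E a) by ring.
  by apply: idealB => //; apply: idealM.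
rewrite -[D.@[a]](divfK fa) mpolyCM -mulrA.
exact: idealM.
Qed.

End Lagrange.

(** * Quasi-fixed points modulo a large prime *)

Section Reduction.

Lemma intr_pchar_neq0 (R : nzRingType) p (c : int) :
  p \in [pchar R] -> c != 0 -> (absz c < p)%N -> c%:~R != 0 :> R.
Proof.
move=> pR c0 ltcp; rewrite [c]intEsign rmorphM /= rmorph_sign mulr_sign.
rewrite (fun_if (fun x => x == 0)) oppr_eq0 if_same -(dvdn_pcharf pR).
by apply: contraL ltcp => /dvdn_leq; rewrite absz_gt0 -leqNgt; apply.
Qed.

Lemma mlead_intr_neq0 n (f : {mpoly int[n]}) (R : nzRingType) p :
  f != 0 -> p \in [pchar R] -> (absz (mleadc f) < p)%N -> (mleadc f)%:~R != 0 :> R.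
Proof. by move=> f0 pR; apply: intr_pchar_neq0 pR _; rewrite mleadc_eq0. Qed.

Lemma ev_mpolyX_neq0 n (f : {mpoly int[n]}) (R : comNzRingType) p :
  f != 0 -> p \in [pchar R] -> (absz (mleadc f) < p)%N ->
  ev (fun i => 'X_i) f != 0 :> {mpoly R[n]}.
Proof.
move=> f0 pR fp; rewrite -map_mpoly_ev; apply/eqP => /(congr1 (mcoeff (mlead f))).
by rewrite mcoeff_map_mpoly mcoeff0; apply/eqP/(mlead_intr_neq0 f0 pR fp).
Qed.

Lemma msize_ev_mpolyX n (f : {mpoly int[n]}) (R : comNzRingType) :
  (msize (ev (fun i => 'X_i) f : {mpoly R[n]}) <= msize f)%N.
Proof.
rewrite -map_mpoly_ev [X in (X <= _)%N]msizeE; apply/bigmax_leqP_seq => m.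
rewrite mcoeff_msupp mcoeff_map_mpoly => fm _; apply: msize_mdeg_lt.
by rewrite mcoeff_msupp; apply: contra_neq fm => ->.
Qed.

(** Frobenius fixes integer coefficients, so its iterates commute with integer polynomials. *)
Lemma ev_expXp n (R : comNzRingType) p (v : 'I_n -> R) f m : p \in [pchar R] ->
  ev v f ^+ (p ^ m) = ev (fun i => v i ^+ (p ^ m)) f.
Proof.
move=> pR; elim: m v => [|m IHm] v; first by rewrite expr1; apply: eq_ev.
rewrite expnSr exprM IHm -(pFrobenius_autE pR) rmorph_ev; apply: eq_ev => i /=.
by rewrite pFrobenius_autE -exprM.
Qed.

Definition base_eval p n (m : 'X_{1..n}) := (\sum_(i < n) m i * p ^ i)%N.

Lemma base_eval_inj p n (m m' : 'X_{1..n}) : (forall i, m i < p)%N ->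
  (forall i, m' i < p)%N -> base_eval p m = base_eval p m' -> m = m'.
Proof.
move=> mp m'p eqmm'; apply/mnmP.
suff digits k (a b : 'I_k -> nat) : (forall i, a i < p)%N -> (forall i, b i < p)%N ->
    (\sum_(i < k) a i * p ^ i = \sum_(i < k) b i * p ^ i)%N -> a =1 b.
  exact: digits eqmm'.
elim: k a b {m m' mp m'p eqmm'} => [|k IHk] a b ap bp eqab; first by case.
have p0 : (0 < p)%N by apply: leq_ltn_trans (ap ord0).
have rec (c : 'I_k.+1 -> nat) : (\sum_(i < k.+1) c i * p ^ i =
    (\sum_(i < k) c (lift ord0 i) * p ^ i) * p + c ord0)%N.
  rewrite big_ord_recl muln1 addnC big_distrl; congr (_ + _)%N.
  by apply: eq_bigr => i _ /=; rewrite -mulnA -expnSr.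
rewrite !rec in eqab.
have eq0 : a ord0 = b ord0.
  have := congr1 (modn^~ p) eqab; rewrite /= !modnMDl !modn_small //.
have eqS : (fun i => a (lift ord0 i)) =1 (fun i => b (lift ord0 i)).
  apply: IHk => //; apply/eqP; rewrite -(eqn_pmul2r p0); apply/eqP.
  by move: eqab; rewrite eq0 => /addIn.
by move=> i; case: (unliftP ord0 i) => [j|] ->.
Qed.

Section BaseP.

Variables (R : comNzRingType) (p n : nat) (Q : {mpoly int[n.+1]}).
Hypotheses (pR : p \in [pchar R]) (Qp : (msize Q <= p)%N).

(** What [Q] becomes when the [k]-th variable is replaced by a [p^k]-th power: exponent vectors are
    read in base [p], so monomials of degree below [p] stay distinct. *)
Definition base_poly : {poly R} := ev (fun k : 'I_n.+1 => 'X^(p ^ k)) Q.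

Lemma base_polyE :
  base_poly = \sum_(m <- msupp Q) (Q@_m)%:~R *: 'X^(base_eval p m).
Proof.
rewrite /base_poly evE; apply: eq_bigr => m _.
rewrite -mul_polyC rmorph_int; congr (_ * _).
rewrite /base_eval -prodrXr; apply: eq_bigr => i _.
by rewrite -exprM mulnC.
Qed.

Lemma base_poly_neq0 : Q != 0 -> (absz (mleadc Q) < p)%N -> base_poly != 0.
Proof.
move=> Q0 ltQp; apply/eqP => /(congr1 (fun u : {poly R} => u`_(base_eval p (mlead Q)))).
have dp m i : m \in msupp Q -> (m i < p)%N.
  move=> Qm; apply: leq_ltn_trans (leq_trans (msize_mdeg_lt Qm) Qp).
  by rewrite mdegE (bigD1 i) //= leq_addr.
rewrite base_polyE coef_sum (bigD1_seq (mlead Q)) ?mlead_supp //= big_seq_cond.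
rewrite big1 => [|m /andP[Qm neq_m]]; last first.
  rewrite coefZ coefXn; case: eqP => [eq_m|_]; last by rewrite mulr0.
  case/eqP: neq_m; apply: (base_eval_inj _ _ (esym eq_m)) => i; apply: dp => //.
  by rewrite mlead_supp.
rewrite addr0 coefZ coefXn eqxx mulr1 coef0; apply/eqP.
exact: mlead_intr_neq0 pR ltQp.
Qed.

(** The factor [msize Q] does not depend on [p]; this keeps the final exponent independent of
    [p]. *)
Lemma size_base_poly : (size base_poly <= msize Q * p ^ n)%N.
Proof.
have p0 : (0 < p)%N by apply/prime_gt0/(pcharf_prime pR).
rewrite base_polyE (leq_trans (size_sum _ _ _)) //; apply/bigmax_leqP_seq => m Qm _.
rewrite (leq_trans (size_scale_leq _ _)) // size_polyXn.
apply: (@leq_trans ((mdeg m).+1 * p ^ n)); last by rewrite leq_mul2r msize_mdeg_lt ?orbT.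
rewrite mulSn -add1n leq_add ?expn_gt0 ?p0 //.
rewrite mdegE big_distrl leq_sum // => i _.
by rewrite leq_mul2l leq_pexp2l ?orbT // -ltnS.
Qed.

End BaseP.

(** In a splitting field [L] of [u], each linear factor of [v] divides [X^#|L| - X], so one copy of
    the latter per root, with multiplicity, is enough. *)
Lemma finite_splitting_field p (u : {poly 'F_p}) : prime p -> u != 0 ->
  exists (L : finFieldType) (iota : {rmorphism 'F_p -> L}), p \in [pchar L] /\
  forall v, v %| u -> map_poly iota v %| ('X^#|L| - 'X) ^+ size v.
Proof.
move=> p_pr u0; have [K [rs Ku _]] := FinSplittingFieldFor u0.
pose L := FinFieldExtType K.
exists L, (in_alg K : {rmorphism 'F_p -> L}); split.
  by rewrite (pchar_lalg K) pchar_Fp.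
move=> v vu.
have v0 : v != 0 by apply: contraTneq vu => ->; rewrite dvd0p.
have : map_poly (in_alg K) v %| \prod_(z <- rs) ('X - z%:P).
  by rewrite -(eqp_dvdr _ Ku) dvdp_map.
case/dvdp_prod_XsubC=> msk eq_v.
have size_v : size v = (size (mask msk rs)).+1.
  by rewrite -(size_map_poly (in_alg K)) (eqp_size eq_v) size_prod_XsubC.
rewrite size_v exprS.
suff : map_poly (in_alg K) v %| ('X^#|L| - 'X) ^+ size (mask msk rs).
  by move=> dv; apply: dvdp_mull.
rewrite (eqp_dvdl _ eq_v) {eq_v size_v}.
elim: (mask msk rs) => [|z s IHs]; first by rewrite big_nil expr0 dvd1p.
rewrite big_cons exprS; apply: dvdp_mul => //.
rewrite dvdp_XsubCl rootE !hornerE.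
by rewrite (expf_card (z : L)) subrr.
Qed.

End Reduction.

(** * Solutions of [Phi(x) = x^p] outside a given hypersurface *)

Section QuasiFixedPoints.

Section Ideal.

Variables (n p : nat) (Phi : n.-tuple {mpoly int[n]}) (L : finFieldType).
Hypotheses (pL : p \in [pchar L]) (Phip : forall i, (msize (tnth Phi i) <= p)%N).

Local Notation PL := {mpoly L[n]}.
Local Notation red := (ev (fun i => 'X_i : PL)).
Local Notation F := (fun i => red (tnth Phi i)).

(** The ideal J of the outline, over [L], with the bound on the cofactors forgotten. *)
Definition frob_ideal (h : PL) := exists d, graph_ideal p F d h.

Lemma frob_ideal_ideal : ideal_pred frob_ideal.
Proof.
split=> [|f g [d fd] [e ge]|h f [d [g gd ->]]].
- by exists 0; apply: graph_ideal0.
- exists (maxn d e); apply: graph_idealD.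
    exact: graph_ideal_le (leq_maxl _ _) fd.
  exact: graph_ideal_le (leq_maxr _ _) ge.
- exists (\max_i msize (h * g i))%N, (fun i => h * g i) => [i|].
    exact: leq_bigmax.
  by rewrite mulr_sumr; apply: eq_bigr => i _; rewrite mulrA.
Qed.
Let idJ := frob_ideal_ideal.

Lemma frob_ideal_gen i : frob_ideal ('X_i ^+ p - F i).
Proof.
exists 1%N, (fun j => (j == i)%:R) => [j|].
  by case: eqP => _; rewrite ?msize1 ?msize0.
rewrite (bigD1 i) //= eqxx mul1r big1 ?addr0 // => j /negPf->.
by rewrite mul0r.
Qed.

Lemma frob_ideal_small h : (msize h <= p)%N -> frob_ideal h -> h = 0.
Proof.
move=> hp [d]; apply: graph_ideal_small => // [|i].
  exact/prime_gt0/(pcharf_prime pL).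
exact: leq_trans (msize_ev_mpolyX _ _) (Phip i).
Qed.

Let pPL : p \in [pchar PL]. Proof. by rewrite pchar_lalg. Qed.

(** Raising [X_i^p = F i] to the power [p^j] and moving Frobenius inside [F i] gives [F i] at the
    [X_k^(p^j)], where the induction hypothesis applies. *)
Lemma frob_ideal_orbit j i :
  frob_ideal ('X_i ^+ (p ^ j) - red (orbit_poly Phi j i)).
Proof.
elim: j i => [|j IHj] i.
  by rewrite orbit_poly0 evX expr1 subrr; apply: ideal0.
rewrite orbit_polyS ev_pull expnS exprM.
rewrite -(subrK (F i ^+ (p ^ j)) ('X_i ^+ p ^+ (p ^ j))) -addrA.
apply: idealD => //; first by apply: ideal_congrX => //; apply: frob_ideal_gen.
by rewrite (ev_expXp _ _ _ pPL); apply: ideal_ev_congr.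
Qed.

(** The Nullstellensatz is applied to [I], the preimage under the [p^m]-th power map of the ideal
    generated by J and the [T i]. Modulo J, [D^(p^m)] is [pull m D], which is thus a combination of
    the [T i], whose [C]-th powers lie in J. *)
Lemma frob_ideal_radical (D : {mpoly int[n]}) C m :
  (forall i, frob_ideal ((('X_i ^+ #|L| - 'X_i) ^+ (p ^ m)) ^+ C)) ->
  (forall a : 'I_n -> L, (forall i, ev a (tnth Phi i) = a i ^+ p) -> ev a D = 0) ->
  frob_ideal (red (pull Phi m D) ^+ (n * C).+1).
Proof.
move=> JT vanD; set T := fun i => ('X_i ^+ #|L| - 'X_i : PL) ^+ (p ^ m).
pose I (h : PL) := exists g, frob_ideal (h ^+ (p ^ m) - \sum_i g i * T i).
have exprpD (f g : PL) : (f + g) ^+ (p ^ m) = f ^+ (p ^ m) + g ^+ (p ^ m).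
  have := @ev_expXp 2 PL p (fun i => if i == ord0 then f else g) ('X_ord0 + 'X_ord_max) m pPL.
  by rewrite !rmorphD /= !evX.
have p_gt0 : (0 < p)%N by apply/prime_gt0/(pcharf_prime pL).
have idI : ideal_pred I.
  split=> [|f g [u Ju] [v Jv]|h f [u Ju]].
  - exists (fun=> 0); rewrite expr0n big1 => [|i _]; last by rewrite mul0r.
    by rewrite eqn0Ngt expn_gt0 p_gt0 subr0; apply: ideal0.
  - exists (fun i => u i + v i).
    rewrite exprpD (eq_bigr (fun i => u i * T i + v i * T i)); last first.
      by move=> i _; rewrite mulrDl.
    by rewrite big_split opprD addrACA; apply: idealD.
  - exists (fun i => h ^+ (p ^ m) * u i).
    rewrite exprMn (eq_bigr (fun i => h ^+ (p ^ m) * (u i * T i))); last first.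
      by move=> i _; rewrite mulrA.
    by rewrite -mulr_sumr -mulrBr; apply: idealM.
have ID : I (red D).
  apply: finite_nullstellensatz => // [i|a].
    exists (fun j => (j == i)%:R); rewrite (bigD1 i) //= eqxx mul1r big1.
      by rewrite addr0 subrr; apply: ideal0.
    by move=> j /negPf->; rewrite mul0r.
  have ev_red f : (red f).@[a] = ev a f.
    rewrite (rmorph_ev (meval a)); apply: eq_ev => i /=.
    by rewrite mevalXU.
  rewrite ev_red => Da.
  (* As [D] vanishes at all solutions of [Phi(a) = a^p], this [a] is not one, and some generator of
     J is nonzero there. *)
  have [j aj] : exists j, ev a (tnth Phi j) != a j ^+ p.
    apply/existsP; apply: contraNT Da => /existsPn aP; apply/eqP/vanD => i.
    by apply/eqP; have := aP i; rewrite negbK.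
  exists ('X_j ^+ p - F j).
    exists (fun=> 0); rewrite [X in _ - X]big1 => [|i _]; last by rewrite mul0r.
    have pm_gt0 : (0 < p ^ m)%N by rewrite expn_gt0 p_gt0.
    rewrite subr0 -(prednK pm_gt0) exprS mulrC.
    by apply: idealM => //; apply: frob_ideal_gen.
  by rewrite mevalB rmorphXn /= mevalXU ev_red subr_eq0 eq_sym.
case: ID => g Jg.
have JE : frob_ideal (red (pull Phi m D) - \sum_i g i * T i).
  rewrite -(subrK (red D ^+ (p ^ m)) (red (pull Phi m D))) -addrA; apply: idealD => //.
  rewrite (ev_expXp _ _ _ pPL) ev_pull; apply: ideal_ev_congr => // i.
  rewrite -opprB -mulN1r; apply: idealM => //.
  exact: frob_ideal_orbit.
apply: ideal_congr (ideal_congrX idJ (n * C).+1 JE) _ => //.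
rewrite -[n in (n * C)%N](size_enum_ord n) enumT; apply: ideal_expr_sum => // i.
by rewrite exprMn; apply: idealM => //; apply: JT.
Qed.

(** Modulo J the relation says that [base_poly] vanishes at [u = X_i^(p^m)], hence so does its
    multiple [(X^#|L| - X)^(C * p^n)]; and [u^#|L| - u] is [(X_i^#|L| - X_i)^(p^m)]. *)
Lemma frob_ideal_base_poly (Q : {mpoly int[n.+1]}) m C i (iota : {rmorphism 'F_p -> L}) :
  ev (fun k : 'I_n.+1 => orbit_poly Phi (m + k) i) Q = 0 ->
  map_poly iota (base_poly 'F_p p Q) %| ('X^#|L| - 'X) ^+ (C * p ^ n) ->
  frob_ideal ((('X_i ^+ #|L| - 'X_i) ^+ (p ^ (m + n))) ^+ C).
Proof.
move=> Qm /dvdpP[w Ew]; pose u : PL := 'X_i ^+ (p ^ m).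
have Ju : frob_ideal (horner_alg u (map_poly iota (base_poly 'F_p p Q))).
  rewrite !rmorph_ev; set t := _ \o _.
  have -> : ev t Q = ev t Q - ev (fun k : 'I_n.+1 => red (orbit_poly Phi (m + k) i)) Q.
    by rewrite -(ev_ev (fun i => 'X_i : PL) Q) Qm rmorph0 subr0.
  apply: ideal_ev_congr => // k.
  by rewrite /t /= map_polyXn rmorphXn /= horner_algX -exprM -expnD; apply: frob_ideal_orbit.
have := congr1 (horner_alg u) Ew.
rewrite rmorphXn rmorphB rmorphXn rmorphM /= horner_algX => Eu.
suff -> : ('X_i ^+ #|L| - 'X_i) ^+ (p ^ (m + n)) ^+ C = (u ^+ #|L| - u) ^+ (C * p ^ n).
  by rewrite Eu; apply: idealM.
rewrite expnD !exprM [in RHS]exprAC; congr (_ ^+ _ ^+ _).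
rewrite -[LHS](_ : (ev (fun i => 'X_i : PL) ('X_i ^+ #|L| - 'X_i)) ^+ (p ^ m) = _).
  rewrite (ev_expXp _ _ _ pPL) rmorphB rmorphXn /= !evX.
  by [].
by rewrite rmorphB rmorphXn /= evX.
Qed.

End Ideal.

Lemma quasi_fixed_point n (Phi : n.-tuple {mpoly int[n]}) D : pull Phi n D != 0 ->
  exists N, forall p, prime p -> (N < p)%N ->
  exists2 L : finFieldType, p \in [pchar L] &
  exists2 x : 'I_n -> L, (forall i, ev x (tnth Phi i) = x i ^+ p) & ev x D != 0.
Proof.
move=> D0.
have exQ (i : 'I_n) : exists Q : {mpoly int[n.+1]}, Q != 0 /\
    ev (fun k : 'I_n.+1 => orbit_poly Phi (n + k) i) Q = 0.
  by have [Q QP _] := orbit_relation Phi i; exists Q.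
have [Q QP] := choice exQ.
pose C := (\max_i msize (Q i))%N.
(* The relations link the iterates from [n] to [n + n], whence the exponent [p ^ (n + n)]; by
   stabilization [D] stays nonzero under the extra [n] iterates. *)
pose E := pull Phi (n + n) D ^+ (n * C).+1.
have E0 : E != 0.
  by apply: expf_neq0; apply: contra_neq D0 => /pull_eq0_add.
(* Beyond this bound Phi, the [Q i] and [E] have degree below [p], and the leading coefficients of
   the [Q i] and [E] survive modulo [p]. *)
exists (\max_i maxn (msize (tnth Phi i)) (maxn (msize (Q i)) (absz (mleadc (Q i))))
        + (msize E + absz (mleadc E)))%N => p p_pr ltNp.
have boundP (i : 'I_n) : [/\ msize (tnth Phi i) <= p, msize (Q i) <= p
    & absz (mleadc (Q i)) < p]%N.
  have := leq_bigmax (F := fun i : 'I_n => maxn (msize (tnth Phi i))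
    (maxn (msize (Q i)) (absz (mleadc (Q i))))) i.
  by move: ltNp; rewrite !geq_max => ltNp /and3P[]; split; lia.
have [Ep ltEp] : (msize E <= p)%N /\ (absz (mleadc E) < p)%N by split; lia.
have pFp : p \in [pchar 'F_p] by rewrite pchar_Fp.
pose q i := base_poly 'F_p p (Q i).
have q0 i : q i != 0.
  by have [_ Qp ltQp] := boundP i; apply: base_poly_neq0 => //; case: (QP i).
(* One field has to split all the [q i], hence their product. *)
have prodq0 : \prod_i q i != 0 by apply/prodf_neq0 => i _; apply: q0.
have [L [iota [pL Liota]]] := finite_splitting_field p_pr prodq0.
exists L => //; apply: contrapT => nopoint.
have : ev (fun i => 'X_i) E != 0 :> {mpoly L[n]} by apply: ev_mpolyX_neq0 pL ltEp.
case/eqP; apply: (@frob_ideal_small _ p Phi L) => //.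
- by move=> i; case: (boundP i).
- exact: leq_trans (msize_ev_mpolyX _ _) Ep.
rewrite rmorphXn; apply: frob_ideal_radical => // [i|a aP]; last first.
  by apply: contrapT => /eqP Da; apply: nopoint; exists a.
have [_ Qi] := QP i; apply: frob_ideal_base_poly Qi _ => //.
apply: (dvdp_trans (Liota (q i) _)); first by rewrite (bigD1 i) //= dvdp_mulIl.
apply: dvdp_exp2l; rewrite (leq_trans (size_base_poly (Q i) pFp)) //.
by rewrite leq_mul2r leq_bigmax orbT.
Qed.

End QuasiFixedPoints.

(** * Lifting to the p-adic integers *)

Section TangentPeriod.

Variables (n p : nat) (Phi : n.-tuple {mpoly int[n]}) (L : finFieldType).
Variables (x : 'I_n -> L) (g h : 'I_n -> {mpoly int[n]}).
Hypotheses (pL : p \in [pchar L]) (xfix : forall i, ev x (tnth Phi i) = x i ^+ p).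
Hypotheses (g0 : forall i, pull Phi n (g i) = 0) (hx : forall i, ev x (h i) != 0).
Hypothesis unram : forall i (y z : 'I_n -> L),
  (forall j, dev y z (tnth Phi j) = 0) -> dev y z (g i) = 0 ->
  ev y (h i) != 0 -> z i = 0.

Local Notation pull := (pull Phi).
Local Notation orbit_poly := (orbit_poly Phi).

Definition tangent (y z : 'I_n -> L) := forall f, pull n f = 0 -> dev y z f = 0.

Definition orbit_dev j (z : 'I_n -> L) i : L := dev x z (orbit_poly j i).

Lemma quasi_fixed_orbit j i : ev x (orbit_poly j i) = x i ^+ (p ^ j).
Proof.
elim: j i => [|j IHj] i; first by rewrite orbit_poly0 evX expr1.
rewrite orbit_polyS ev_pull (eq_ev _ IHj) -(ev_expXp x _ j pL) xfix.
by rewrite -exprM expnS.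
Qed.

Lemma dev_pull j z f :
  dev x z (pull j f) = dev (fun i => x i ^+ (p ^ j)) (orbit_dev j z) f.
Proof.
by rewrite pullE dev_comp; apply: eq_dev => i //; apply: quasi_fixed_orbit.
Qed.

Lemma tangent_orbit j z : tangent x z ->
  tangent (fun i => x i ^+ (p ^ j)) (orbit_dev j z).
Proof.
move=> xz f f0; rewrite -dev_pull; apply: xz.
by rewrite pull_add addnC -pull_add f0 rmorph0.
Qed.

(** Phi is unramified at every point [x^(p^j)] of the orbit, since [h i] takes there the [p^j]-th
    power of its nonzero value at [x]. *)
Lemma orbit_dev_ker j z : tangent x z -> (forall i, orbit_dev j z i = 0) ->
  forall i, z i = 0.
Proof.
move=> xz; elim: j => [|j IHj] z0.
  by move=> i; rewrite -(z0 i) /orbit_dev orbit_poly0 devX.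
apply: IHj => i; apply: (unram (y := fun k => x k ^+ (p ^ j))) => [k||].
- by rewrite -dev_pull -orbit_polyS; apply: z0.
- exact: tangent_orbit.
- by rewrite -(ev_expXp x _ j pL) expf_neq0.
Qed.

Lemma orbit_dev_inj j z z' : tangent x z -> tangent x z' ->
  orbit_dev j z =1 orbit_dev j z' -> z =1 z'.
Proof.
move=> xz xz' zz' i; apply/eqP; rewrite -subr_eq0; apply/eqP.
apply: (@orbit_dev_ker j (fun i => z i - z' i)) => [f f0|k].
  by rewrite dev_dirB xz // xz' // subrr.
by rewrite /orbit_dev dev_dirB [dev x z _]zz' subrr.
Qed.

Lemma quasi_fixed_period l k i : #|L| = (p ^ l)%N -> x i ^+ (p ^ (l * k)) = x i.
Proof.
move=> Ll; elim: k => [|k IHk]; first by rewrite muln0 expr1.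
by rewrite mulnS expnD exprM -Ll expf_card.
Qed.

(** [x] is its own image under [Phi^(l * n)], which factors through [Phi^n]. *)
Lemma quasi_fixed_zero l f : #|L| = (p ^ l)%N -> (0 < l)%N -> pull n f = 0 ->
  ev x f = 0.
Proof.
move=> Ll l0 f0.
have -> : ev x f = ev x (pull (l * n) f).
  rewrite ev_pull; apply: eq_ev => i.
  by rewrite quasi_fixed_orbit quasi_fixed_period.
have len : (n <= l * n)%N by rewrite leq_pmull.
by rewrite -(subnKC len) -pull_add f0 !rmorph0.
Qed.

(** [Phi^l] fixes [x], so the differentials of the [Phi^(l * c)] at [x] are self-maps of a finite
    set. Two of them agree, and injectivity on tangent vectors cancels the earlier one. *)
Lemma tangent_period l : #|L| = (p ^ l)%N -> (0 < l)%N ->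
  exists a, [/\ (0 < a)%N, forall i, ev x (orbit_poly a i) = x i &
    forall z, tangent x z -> forall i, dev x z (orbit_poly a i) = z i].
Proof.
move=> Ll l0.
have orbit_devD j k z i : orbit_dev (j + l * k) z i = orbit_dev j (orbit_dev (l * k) z) i.
  rewrite /orbit_dev -pull_orbit dev_pull; apply: eq_dev => // m.
  exact: quasi_fixed_period.
pose V : finType := {ffun 'I_n -> L}.
pose th c : {ffun V -> V} := [ffun z : V => [ffun i => orbit_dev (l * c) z i]].
have [c [d [ltcd eq_cd]]] : exists c d, (c < d)%N /\ th c = th d.
  pose N := #|{ffun V -> V}|.+1; pose u (c : 'I_N) := th c.
  have [|/injectivePn[c [d ne_cd eq_cd]]] := boolP (injectiveb u).
    by move/injectiveP/leq_card; rewrite card_ord ltnn.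
  case: (ltngtP c d) => [ltcd|ltdc|/val_inj ecd].
  - by exists c, d.
  - by exists d, c.
  - by rewrite ecd eqxx in ne_cd.
have thE (b : nat) z i : th b [ffun k => z k] i = orbit_dev (l * b) z i.
  by rewrite !ffunE; apply: eq_dev => // k; rewrite ffunE.
exists (l * (d - c))%N; split; first by rewrite muln_gt0 l0 subn_gt0.
  by move=> i; rewrite quasi_fixed_orbit quasi_fixed_period.
move=> z xz i; apply/esym; move: i; apply: (orbit_dev_inj (j := (l * c)%N)) => //.
  move=> f f0; have := @tangent_orbit (l * (d - c)) z xz f f0.
  by apply: etrans; apply: eq_dev => // i; rewrite quasi_fixed_period.
move=> i; rewrite -orbit_devD -mulnDr subnKC ?(ltnW ltcd) //.
by rewrite -!thE eq_cd.
Qed.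

End TangentPeriod.

(** * Return times of the points of V over [x] *)

Section PadicDynamics.

Variables (n p a : nat) (Phi : n.-tuple {mpoly int[n]}) (L : finFieldType).
Variables (x : 'I_n -> L) (R : comNzRingType) (pi : {rmorphism R -> L}).
Hypotheses (pL : p \in [pchar L]) (ax : forall i, ev x (orbit_poly Phi a i) = x i).
Hypothesis aT : forall z, tangent Phi x z ->
  forall i, dev x z (orbit_poly Phi a i) = z i.
Hypothesis ker_pi : forall u, pi u = 0 -> exists v, u = p%:R * v.
Hypothesis p_reg : forall u : R, p%:R * u = 0 -> u = 0.

Local Notation pull := (pull Phi).
Local Notation orbit_poly := (orbit_poly Phi).

Definition above (X : 'I_n -> R) :=
  (forall f, pull n f = 0 -> ev X f = 0) /\ forall i, pi (X i) = x i.

Definition flow m (X : 'I_n -> R) i : R := ev X (orbit_poly m i).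

Lemma flowD m k X i : flow (m + k) X i = flow m (flow k X) i.
Proof. by rewrite /flow -pull_orbit ev_pull. Qed.

Lemma above_flow m X : above X -> above (flow (a * m) X).
Proof.
move=> [X0 Xx]; split=> [f f0|i].
  by rewrite -ev_pull; apply: X0; rewrite pull_add addnC -pull_add f0 rmorph0.
rewrite rmorph_ev (eq_ev _ Xx); elim: m i => [|m IHm] i.
  by rewrite muln0 orbit_poly0 evX.
by rewrite mulnS -pull_orbit ev_pull (eq_ev _ IHm) ax.
Qed.

Lemma pi_p : pi p%:R = 0.
Proof. by rewrite rmorph_nat; apply: pcharf0. Qed.

Lemma p_regX k (u : R) : p%:R ^+ k * u = 0 -> u = 0.
Proof.
elim: k => [|k IHk]; first by rewrite mul1r.
by rewrite exprS -mulrA => /p_reg.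
Qed.

(* The direction from [Y] to [X] reduces to a tangent vector of [V] at [x], on
   which the differential of [Phi^a] is the identity. *)
Lemma flow_congr k X Y : (0 < k)%N -> above X -> above Y ->
  (forall i, exists c, X i = Y i + p%:R ^+ k * c) ->
  forall i, exists r, flow a X i - flow a Y i = X i - Y i + p%:R ^+ k.+1 * r.
Proof.
case: k => // k _ [X0 Xx] [Y0 Yx] /choice[Z XZ] i.
have taylor f := ev_taylor Y Z (p%:R ^+ k.+1) f.
have evXf f : ev X f = ev (fun i => Y i + p%:R ^+ k.+1 * Z i) f by apply: eq_ev.
have pi_dev f : pi (dev Y Z f) = dev x (pi \o Z) f.
  by rewrite rmorph_dev; apply: eq_dev.
have xZ : tangent Phi x (pi \o Z).
  move=> f f0; have [r] := taylor f; rewrite -evXf X0 // Y0 // add0r => Er.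
  have : p%:R ^+ k.+1 * (dev Y Z f + p%:R ^+ k.+1 * r) = 0 by rewrite Er; ring.
  move/p_regX/(congr1 pi); rewrite rmorphD rmorph0 pi_dev rmorphM rmorphXn.
  by rewrite /= pi_p expr0n mul0r addr0.
have [v Ev] : exists v, dev Y Z (orbit_poly a i) - Z i = p%:R * v.
  by apply: ker_pi; rewrite rmorphB pi_dev aT //= subrr.
have [r Er] := taylor (orbit_poly a i).
(* The exponent [k.+1] being positive, the quadratic remainder, a multiple of [p^(2k+2)], is
   absorbed in [p^(k+2)]. *)
exists (v + p%:R ^+ k * r); rewrite /flow evXf Er XZ.
have -> : dev Y Z (orbit_poly a i) = Z i + p%:R * v by rewrite -Ev; ring.
by rewrite !exprS; ring.
Qed.

Lemma flow_congr_iter k m X Y : (0 < k)%N -> above X -> above Y ->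
  (forall i, exists c, X i = Y i + p%:R ^+ k * c) ->
  forall i, exists r,
    flow (a * m) X i - flow (a * m) Y i = X i - Y i + p%:R ^+ k.+1 * r.
Proof.
move=> k0 aX aY XY; elim: m => [|m IHm] i.
  by exists 0; rewrite muln0 /flow orbit_poly0 !evX mulr0 addr0.
have XYm j : exists c, flow (a * m) X j = flow (a * m) Y j + p%:R ^+ k * c.
  have [r Er] := IHm j; have [c Ec] := XY j.
  exists (c + p%:R * r); rewrite -(subrK (flow (a * m) Y j) (flow (a * m) X j)).
  by rewrite Er Ec exprS; ring.
have [r Er] := IHm i.
have [s Es] := flow_congr k0 (above_flow m aX) (above_flow m aY) XYm i.
by exists (s + r); rewrite mulnS !flowD Es Er; ring.
Qed.

(** Modulo [p^(k+2)] each application of [Phi^(a * p^k)] along the orbit of [X] adds the same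
    displacement as the first, a multiple of [p^(k+1)]; [p] of them add up to a multiple of
    [p^(k+2)]. *)
Lemma flow_return k X : above X ->
  forall i, exists c, flow (a * p ^ k) X i = X i + p%:R ^+ k.+1 * c.
Proof.
move=> aX; elim: k => [|k IHk] i.
  have [c Ec] : exists c, flow (a * p ^ 0) X i - X i = p%:R * c.
    apply: ker_pi; rewrite rmorphB; have [_ ->] := above_flow (p ^ 0) aX.
    by case: aX => _ ->; rewrite subrr.
  by exists c; rewrite expr1 -Ec addrC subrK.
pose M := (a * p ^ k)%N.
have aXM := above_flow (p ^ k) aX.
have step j : exists r, flow (M * j) X i - X i =
    (flow M X i - X i) *+ j + p%:R ^+ k.+2 * r.
  elim: j => [|j [r Er]].
    by exists 0; rewrite muln0 /flow orbit_poly0 evX subrr mulr0 addr0.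
  have [s Es] := flow_congr_iter (p ^ k * j) (ltn0Sn k) aXM aX IHk i.
  exists (s + r); rewrite mulnS addnC flowD mulrS.
  rewrite mulnA -/M in Es; rewrite -(subrK (flow (M * j) X i) (flow _ _ _)) Es.
  by rewrite -addrA Er; ring.
have [c Ec] := IHk i; have [r Er] := step p.
exists (c + r); rewrite -(subrK (X i) (flow _ _ _)) expnSr mulnA Er.
by rewrite -/M in Ec; rewrite Ec -mulr_natl !exprS; ring.
Qed.

End PadicDynamics.

Section PadicIntegers.

Variables (p : nat) (p_pr : prime p).

Lemma padic_natr m k : (m%:R : padic_int p_pr) k = (m%:Z %% (p ^ k)%N%:Z)%Z.
Proof.
elim: m => [//|m IHm]; rewrite mulrS.
have -> : (1 + m%:R : padic_int p_pr) k =
    modz ((1 : padic_int p_pr) k + (m%:R : padic_int p_pr) k) (p ^ k)%N%:Z by [].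
by rewrite IHm modzDml modzDmr -intS.
Qed.

Lemma integers_mulp_eq0 (K : fieldExtType (padic_rat p_pr)) (u : integers K) :
  p%:R * u = 0 -> u = 0.
Proof.
move/(congr1 val); rewrite rmorphM rmorph_nat rmorph0 => /eqP.
rewrite mulf_eq0 => /orP[/eqP pK|/eqP u0]; last exact: val_inj.
have : (p%:R : padic_int p_pr) = 0.
  apply/eqP; rewrite -tofrac_eq0 rmorph_nat.
  by rewrite -(fmorph_eq0 (in_alg K)) rmorph_nat pK.
(* The residue modulo [p^2] is examined, since the one modulo [p] is zero. *)
move/(congr1 (fun w : padic_int p_pr => w 2%N)); rewrite padic_natr /= mod0z.
have p_gt1 := prime_gt1 p_pr.
rewrite modz_small ?ltz_nat ?ltn_Pmulr ?(ltnW p_gt1) //.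
by case=> p0; rewrite p0 in p_gt1.
Qed.

End PadicIntegers.

Lemma pmap_eval_iter n (Phi : n.-tuple {mpoly int[n]}) (R : comNzRingType)
    (X : n.-tuple R) m i :
  tnth (iter m (pmap_eval Phi (R := R)) X) i = flow Phi m (tnth X) i.
Proof.
elim: m i => [|m IHm] i; first by rewrite /flow orbit_poly0 evX.
rewrite iterS tnth_mktuple /flow orbit_polyS ev_pull.
rewrite -(eq_ev (tnth Phi i) IHm).
by rewrite ev.unlock.
Qed.

Lemma image_idealE n (Phi : n.-tuple {mpoly int[n]}) f :
  image_ideal Phi f <-> pull Phi n f = 0.
Proof. by rewrite pull.unlock. Qed.

Lemma zero_locus_ev n (I : {mpoly int[n]} -> Prop) (R : comNzRingType) (X : n.-tuple R) :
  zero_locus I X <-> forall f, I f -> ev (tnth X) f = 0.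
Proof. by rewrite ev.unlock. Qed.

Theorem theorem2p12 (n : nat) (Phi : n.-tuple {mpoly int[n]})
    (IW : {mpoly int[n]} -> Prop)
    (properW : proper_closed_subscheme IW (image_ideal Phi)) :
  exists N : nat, forall (p : nat) (p_pr : prime p), (N < p)%N ->
  exists l : nat, (0 < l)%N /\
  exists Fq : finFieldType, #|Fq| = (p ^ l)%N /\
  exists x : n.-tuple Fq,
    zero_locus (image_ideal Phi) x /\ ~ zero_locus IW x /\
  exists a : nat, (0 < a)%N /\
  forall (Qq : fieldExtType (padic_rat p_pr))
         (pi : {rmorphism integers Qq -> Fq}), is_reduction pi ->
  forall X : n.-tuple (integers Qq),
    zero_locus (image_ideal Phi) X -> map_tuple pi X = x ->
    (forall k : nat,
       congr_mod (p ^ k) (iter (a * p ^ k) (pmap_eval Phi (R := integers Qq)) X) X)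
    /\ uniformly_recurrent (padic_nbhd p (zero_locus (image_ideal Phi) (R := integers Qq)))
         (pmap_eval Phi (R := integers Qq)) X.
Proof.
have [_ _ [D0 WD0 ID0]] := properW.
have exR i := let: ex_intro2 _ _ gh := orbit_relation Phi i in gh.
have [g exg] := choice exR.
have [h gh] := choice exg.
(* [D0] keeps [x] off W, and the [h i] make Phi unramified along its orbit. *)
pose D := D0 * \prod_i h i.
have D_neq0 : pull Phi n D != 0.
  rewrite rmorphM mulf_neq0 //; first by apply/eqP; rewrite -image_idealE.
  by rewrite rmorph_prod; apply/prodf_neq0 => i _; case: (gh i).
have [N NP] := quasi_fixed_point D_neq0.
exists N => p p_pr ltNp; have [L pL [x xfix]] := NP p p_pr ltNp.
rewrite rmorphM mulf_eq0 rmorph_prod negb_or => /andP[xD0 /prodf_neq0 xh].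
have [l Ll] : exists l, #|L| = (p ^ l)%N by exists (logn p #|L|); apply: card_pprimeChar.
have l_gt0 : (0 < l)%N.
  by rewrite lt0n; apply: contraTneq (finNzRing_gt1 L) => l0; rewrite Ll l0.
exists l; split => //; exists L; split => //.
exists [tuple x i | i < n]; split.
  apply/zero_locus_ev => f /image_idealE f0.
  have -> : ev (tnth [tuple x i | i < n]) f = ev x f.
    by apply: eq_ev => i; rewrite tnth_mktuple.
  exact (quasi_fixed_zero pL xfix Ll l_gt0 f0).
split.
  move/zero_locus_ev => /(_ D0 WD0) D0x; case/eqP: xD0; rewrite -D0x.
  by apply: eq_ev => i; rewrite tnth_mktuple.
have g0 i : pull Phi n (g i) = 0 by case: (gh i).
have hx i : ev x (h i) != 0 by apply: xh.
have unram i (y z : 'I_n -> L) : (forall j, dev y z (tnth Phi j) = 0) ->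
    dev y z (g i) = 0 -> ev y (h i) != 0 -> z i = 0.
  by case: (gh i) => _ _; apply.
have [a [a_gt0 ax aT]] := tangent_period pL xfix g0 hx unram Ll l_gt0.
exists a; split => // Qq pi [_ ker_pi] X VX Xx.
have aX : above Phi x pi (tnth X).
  split=> [f f0|i]; first by move/zero_locus_ev: VX; apply; apply/image_idealE.
  by have /(congr1 (fun t => tnth t i)) := Xx; rewrite tnth_map tnth_mktuple.
have ret Y : above Phi x pi Y -> forall k i, exists c,
    flow Phi (a * p ^ k) Y i = Y i + (p ^ k)%:R * c.
  move=> aY k i.
  have [|c ->] := flow_return pL ax aT _ (@integers_mulp_eq0 p p_pr Qq) k aY i.
    by move=> u /ker_pi.
  by exists (p%:R * c); rewrite natrX exprSr mulrA.
split=> [k i|U [k Uk]].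
  have [c Ec] := ret _ aX k i; exists c.
  by rewrite pmap_eval_iter Ec addrC addKr.
(* Every multiple of [M] brings [X] back to itself modulo [p^k], so the gaps are at most [M]. *)
exists (a * p ^ k)%N => m; pose M := (a * p ^ k)%N.
have M_gt0 : (0 < M)%N by rewrite muln_gt0 a_gt0 expn_gt0 prime_gt0.
have retj j i : exists c, flow Phi (M * j) (tnth X) i = tnth X i + (p ^ k)%:R * c.
  elim: j i => [|j IHj] i.
    by exists 0; rewrite muln0 /flow orbit_poly0 evX mulr0 addr0.
  have aXj : above Phi x pi (flow Phi (M * j) (tnth X)).
    by rewrite -mulnA; apply: above_flow.
  have [c Ec] := ret _ aXj k i; have [d Ed] := IHj i.
  by exists (d + c); rewrite mulnS flowD Ec Ed mulrDr addrA.
(* The target is the first multiple of [M] strictly after [m]; when [M] divides [m] the shift is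
   [M], not 0. *)
exists (M - m %% M)%N; first exact: leq_subr.
have -> : (m + (M - m %% M) = M * (m %/ M).+1)%N.
  rewrite {1}(divn_eq m M) -addnA subnKC ?(ltnW (ltn_pmod _ M_gt0)) //.
  by rewrite mulnS mulnC addnC.
apply: Uk => [|i]; last first.
  have [c Ec] := retj (m %/ M).+1 i; exists c.
  by rewrite pmap_eval_iter Ec addrC addKr.
apply/zero_locus_ev => f /image_idealE f0.
have [V0 _] := above_flow ax (p ^ k * (m %/ M).+1) aX.
by rewrite -(V0 f f0); apply: eq_ev => i; rewrite pmap_eval_iter mulnA.
Qed.
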